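(* Every diagram group of every directed $2$-complex is totally orderable. That is, for every directed $2$-complex $\mathcal{K}$ and every nonempty $1$-path $w$ in $\mathcal{K}$, there exists a total order $<$ on the diagram group $G=\mathcal{D}(\mathcal{K},w)$ such that for all $a,b,c\in G$, $a<b$ implies both $ca<cb$ and $ac<bc$.
   Context: A directed $2$-complex $\mathcal{K}$ consists of: a directed graph (each edge $e$ has an initial vertex $\iota(e)$ and a terminal vertex $\tau(e)$); a set of $2$-cells; for each $2$-cell $f$, two nonempty directed paths $\lceil f\rceil$ (top) and $\lfloor f\rfloor$ (bottom) in the graph with the same initial vertex and the same terminal vertex; and a fixed-point-free involution $f\mapsto f^{-1}$ on $2$-cells with $\lceil f^{-1}\rceil=\lfloor f\rfloor$, $\lfloor f^{-1}\rfloor=\lceil f\rceil$. A $1$-path is a (possibly empty) directed path in the graph. The Squier complex $\mathrm{Sq}(\mathcal{K})$ is the $2$-dimensional cell complex whose vertices are the nonempty $1$-paths; whose edges are the triples $(p,f,q)$, with $p,q$ $1$-paths and $f$ a $2$-cell such that $p\lceil f\rceil q$ is a $1$-path, going from $p\lceil f\rceil q$ to $p\lfloor f\rfloor q$, with $(p,f,q)^{-1}=(p,f^{-1},q)$; and which has, for every $(p,f,q,g,r)$ with $f,g$ $2$-cells and $p\lceil f\rceil q\lceil g\rceil r$ a $1$-path, a $2$-cell attached along the loop $(p,f,q\lceil g\rceil r)\,(p\lfloor f\rfloor q,g,r)\,(p,f,q\lfloor g\rfloor r)^{-1}\,(p\lceil f\rceil q,g,r)^{-1}$. For a nonempty $1$-path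 $w$, the diagram group is $\mathcal{D}(\mathcal{K},w)=\pi_1(\mathrm{Sq}(\mathcal{K}),w)$. *)

(* Defs.v *)
From HB Require Import structures.
From Stdlib Require Export Relation_Operators.
From mathcomp Require Export all_boot boolp.

Set Implicit Arguments.
Unset Strict Implicit.
Unset Printing Implicit Defensive.

Local Open Scope quotient_scope.

Section Walk.
Variables (V E : Type) (src tgt : E -> V).

(* [walk x s y]: the edges of [s] form a directed path from [x] to [y]. The
   empty list is the empty path at any vertex. *)
Fixpoint walk (x : V) (s : seq E) (y : V) : Prop :=
  if s is e :: s' then src e = x /\ walk (tgt e) s' y else x = y.

Lemma walk_cat x s1 s2 y :
  walk x (s1 ++ s2) y <-> exists z, walk x s1 z /\ walk z s2 y.
Proof.
elim: s1 x => [|e s1 IH] x /=; first by split=> [|[z [-> //]]]; exists x.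
split=> [[-> /IH [z [w1 w2]]]|[z [[-> w1] w2]]]; first by exists z.
by split=> //; apply/IH; exists z.
Qed.

Lemma walk_inj x1 s y1 x2 y2 :
  s <> [::] -> walk x1 s y1 -> walk x2 s y2 -> x1 = x2 /\ y1 = y2.
Proof.
case: s => // e s _ /= [<- w1] [<- w2]; split=> //.
by elim: s (tgt e) w1 w2 => [x <- <-|e' s IH x /= [_ /IH w1] [_ /w1]].
Qed.

Lemma walk_swap s1 t t' s2 x y u v : t <> [::] ->
  walk u t v -> walk u t' v ->
  walk x (s1 ++ t ++ s2) y -> walk x (s1 ++ t' ++ s2) y.
Proof.
move=> t0 wt wt' /walk_cat [z [w1 /walk_cat [z' [wz w2]]]].
have [zu z'v] := walk_inj t0 wz wt; subst z z'.
by apply/walk_cat; exists u; split=> //; apply/walk_cat; exists v.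
Qed.

End Walk.

Record complex2 := Complex2 {
  vertex : Type;
  edge : Type;
  face : Type;
  eini : edge -> vertex;
  eter : edge -> vertex;
  einv : edge -> edge;
  eini_inv : forall e, eini (einv e) = eter e;
  einvK : involutive einv;
  einv_neq : forall e, einv e <> e;
  boundary : face -> seq edge;
  boundary_loop :
    forall c, exists x, walk eini eter x (boundary c) x
}.

Section Pi1.
Variables (X : complex2) (x0 : vertex X).
Local Notation ewalk := (walk (@eini X) (@eter X)).

Record loop := Loop {
  loop_edges :> seq (edge X);
  loop_walk : ewalk x0 loop_edges x0
}.

HB.instance Definition _ := gen_eqMixin loop.
HB.instance Definition _ := gen_choiceMixin loop.

Lemma loop_inj (a b : loop) : loop_edges a = loop_edges b -> a = b.
Proof.
case: a b => [s ws] [t wt] /= st; subst t.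
by rewrite (Prop_irrelevance ws wt).
Qed.

Inductive null_word : seq (edge X) -> Prop :=
| null_backtrack e : null_word [:: e; einv e]
| null_boundary c : null_word (boundary c).

(* Both sides are loops at [x0], so an insertion is only allowed where the
   inserted word is composable with its context. Other base points and the
   opposite orientation of a boundary word are obtained by combining it with
   backtracks. *)
Definition elementary_homotopy (a b : loop) : Prop :=
  exists s1 t s2, [/\ null_word t, loop_edges a = s1 ++ t ++ s2
                    & loop_edges b = s1 ++ s2].

Definition homotopic : loop -> loop -> Prop :=
  clos_refl_sym_trans loop elementary_homotopy.

Definition homotopicb (a b : loop) : bool := `[< homotopic a b >].

Lemma homotopicb_refl : reflexive homotopicb.
Proof. by move=> a; apply/asboolP; apply: rst_refl. Qed.

Lemma homotopicb_sym : symmetric homotopicb.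
Proof. by move=> a b; apply/asboolP/asboolP; apply: rst_sym. Qed.

Lemma homotopicb_trans : transitive homotopicb.
Proof.
by move=> b a c /asboolP ab /asboolP bc; apply/asboolP; apply: rst_trans bc.
Qed.

Canonical homotopic_equiv :=
  EquivRel homotopicb homotopicb_refl homotopicb_sym homotopicb_trans.

Definition pi1 := {eq_quot homotopicb}.

HB.instance Definition _ := EqQuotient.on pi1.
HB.instance Definition _ := Choice.on pi1.

Lemma pi1P (a b : loop) : \pi_pi1 a = \pi_pi1 b <-> homotopic a b.
Proof.
split=> [ab|ab]; first by apply/asboolP; apply/(eqmodP homotopic_equiv).
by apply/(eqmodP homotopic_equiv); apply/asboolP.
Qed.

Definition loop_one : loop := @Loop [::] (erefl x0).

Lemma loop_mul_subproof (a b : loop) :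
  ewalk x0 (loop_edges a ++ loop_edges b) x0.
Proof. by apply/walk_cat; exists x0; split; apply: loop_walk. Qed.

Definition loop_mul (a b : loop) : loop := Loop (loop_mul_subproof a b).

Definition word_inv (s : seq (edge X)) := rev (map (@einv X) s).

Lemma word_inv_cons e s : word_inv (e :: s) = word_inv s ++ [:: einv e].
Proof. by rewrite /word_inv /= rev_cons cats1. Qed.

Lemma word_invK : involutive word_inv.
Proof.
move=> s; rewrite /word_inv map_rev revK -map_comp -[RHS]map_id.
by apply: eq_map; apply: einvK.
Qed.

Lemma eter_inv (e : edge X) : eter (einv e) = eini e.
Proof. by rewrite -eini_inv einvK. Qed.

Lemma walk_word_inv x s y : ewalk x s y -> ewalk y (word_inv s) x.
Proof.
elim: s x => [|e s IH] x /=; first by move->.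
move=> [<- /IH w]; rewrite word_inv_cons; apply/walk_cat.
by exists (eter e); split=> //=; rewrite eini_inv eter_inv.
Qed.

Definition loop_inv (a : loop) : loop := Loop (walk_word_inv (loop_walk a)).

Lemma homotopic_cancel t s1 s2 (a b : loop) :
  loop_edges a = s1 ++ (t ++ word_inv t) ++ s2 -> loop_edges b = s1 ++ s2 ->
  homotopic a b.
Proof.
elim: t s1 s2 a b => [|e t IH] s1 s2 a b Ea Eb.
  by rewrite (@loop_inj a b) ?Ea ?Eb //; apply: rst_refl.
have wc : ewalk x0 (s1 ++ [:: e; einv e] ++ s2) x0.
  have := loop_walk b; rewrite Eb => /walk_cat [z [w1 w2]].
  have := loop_walk a; rewrite Ea => /walk_cat [z' [w1' /= [ez _]]].
  apply/walk_cat; exists z'; split=> //=; rewrite eini_inv eter_inv; do 2!split=> //.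
  have zz' : z = z'.
    have := conj w1 w1'; elim: (s1) {w1 w1' Ea Eb} (x0) => [x /= [<- <-]|d s IHs x /=] //.
    by case=> [[_ v1] [_ v2]]; apply: IHs (conj v1 v2).
  by rewrite ez -zz'.
apply: (@rst_trans _ _ _ (Loop wc)); last first.
  by apply: rst_step; exists s1, [:: e; einv e], s2; split=> //; left.
apply: (IH (s1 ++ [:: e]) (einv e :: s2)).
  by rewrite Ea word_inv_cons /= -!catA.
by rewrite /= -catA.
Qed.

Lemma homotopic_mull a b c : homotopic a b -> homotopic (loop_mul a c) (loop_mul b c).
Proof.
elim=> {a b} [a b [s1 [t [s2 [nt Ea Eb]]]]|a|a b _|a b d _ h _].
- apply: rst_step; exists s1, t, (s2 ++ loop_edges c).
  by split=> //=; rewrite ?Ea ?Eb -!catA.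
- exact: rst_refl.
- exact: rst_sym.
- exact: rst_trans.
Qed.

Lemma homotopic_mulr a b c : homotopic a b -> homotopic (loop_mul c a) (loop_mul c b).
Proof.
elim=> {a b} [a b [s1 [t [s2 [nt Ea Eb]]]]|a|a b _|a b d _ h _].
- apply: rst_step; exists (loop_edges c ++ s1), t, s2.
  by split=> //=; rewrite ?Ea ?Eb -!catA.
- exact: rst_refl.
- exact: rst_sym.
- exact: rst_trans.
Qed.

Lemma loop_mulA : associative loop_mul.
Proof. by move=> a b c; apply: loop_inj; rewrite /= catA. Qed.

Lemma loop_mul1 : left_id loop_one loop_mul.
Proof. by move=> a; apply: loop_inj. Qed.

Lemma loop_mulr1 : right_id loop_one loop_mul.
Proof. by move=> a; apply: loop_inj; rewrite /= cats0. Qed.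

Lemma loop_mulV a : homotopic (loop_mul a (loop_inv a)) loop_one.
Proof. by apply: (@homotopic_cancel a [::] [::]); rewrite //= cats0. Qed.

Lemma loop_mulVl a : homotopic (loop_mul (loop_inv a) a) loop_one.
Proof.
by apply: (@homotopic_cancel (loop_inv a) [::] [::]); rewrite //= word_invK cats0.
Qed.

Definition pi1_one : pi1 := \pi_pi1 loop_one.
Definition pi1_mul (a b : pi1) : pi1 := \pi_pi1 (loop_mul (repr a) (repr b)).
Definition pi1_inv (a : pi1) : pi1 := \pi_pi1 (loop_inv (repr a)).

Lemma pi1_mulE a b : pi1_mul (\pi_pi1 a) (\pi_pi1 b) = \pi_pi1 (loop_mul a b).
Proof.
apply/pi1P; apply: (@rst_trans _ _ _ (loop_mul a (repr (\pi_pi1 b)))).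
  by apply: homotopic_mull; apply/pi1P; rewrite reprK.
by apply: homotopic_mulr; apply/pi1P; rewrite reprK.
Qed.

Lemma pi1_mulA : associative pi1_mul.
Proof.
move=> a b c; rewrite -[a]reprK -[b]reprK -[c]reprK.
by rewrite (pi1_mulE (repr b)) pi1_mulE (pi1_mulE (repr a)) pi1_mulE loop_mulA.
Qed.

Lemma pi1_mul1 : left_id pi1_one pi1_mul.
Proof. by move=> a; rewrite -[a]reprK pi1_mulE loop_mul1. Qed.

Lemma pi1_mulr1 : right_id pi1_one pi1_mul.
Proof. by move=> a; rewrite -[a]reprK pi1_mulE loop_mulr1. Qed.

Lemma pi1_mulVl : left_inverse pi1_one pi1_inv pi1_mul.
Proof.
move=> a; rewrite -[X in pi1_mul _ X]reprK pi1_mulE.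
by apply/(pi1P (loop_mul _ _)); apply: loop_mulVl.
Qed.

Lemma pi1_mulV : right_inverse pi1_one pi1_inv pi1_mul.
Proof.
move=> a; rewrite -[X in pi1_mul X _]reprK pi1_mulE.
by apply/(pi1P (loop_mul _ _)); apply: loop_mulV.
Qed.

HB.instance Definition _ :=
  isGroup.Build pi1 pi1_mulA pi1_mul1 pi1_mulr1 pi1_mulVl pi1_mulV.

End Pi1.

Record dcomplex2 := DComplex2 {
  dvertex : Type;
  dedge : Type;
  dcell : Type;
  dini : dedge -> dvertex;
  dter : dedge -> dvertex;
  top : dcell -> seq dedge;
  bot : dcell -> seq dedge;
  dinv : dcell -> dcell;
  top_neq0 : forall f, top f <> [::];
  bot_neq0 : forall f, bot f <> [::];
  top_bot : forall f, exists x y,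
    walk dini dter x (top f) y /\ walk dini dter x (bot f) y;
  dinvK : involutive dinv;
  dinv_neq : forall f, dinv f <> f;
  top_inv : forall f, top (dinv f) = bot f;
  bot_inv : forall f, bot (dinv f) = top f
}.

Section Squier.
Variable K : dcomplex2.

Definition one_path (s : seq (dedge K)) : Prop :=
  exists x y, walk (@dini K) (@dter K) x s y.

Record npath := NPath {
  npath_edges :> seq (dedge K);
  npath_neq0 : npath_edges <> [::];
  npath_path : one_path npath_edges
}.

(* Lists of edges suffice for the 1-paths [p], [q], [r] below: an empty one sits
   next to some nonempty top path, which determines its vertex, and a factor of
   a 1-path is a 1-path. *)
Record sq_edge := SqEdge {
  sqe_l : seq (dedge K);
  sqe_cell : dcell K;
  sqe_r : seq (dedge K);
  sqe_path : one_path (sqe_l ++ top sqe_cell ++ sqe_r)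
}.

Record sq_face := SqFace {
  sqf_l : seq (dedge K);
  sqf_cell1 : dcell K;
  sqf_m : seq (dedge K);
  sqf_cell2 : dcell K;
  sqf_r : seq (dedge K);
  sqf_path :
    one_path (sqf_l ++ top sqf_cell1 ++ sqf_m ++ top sqf_cell2 ++ sqf_r)
}.

Lemma npath_inj (u v : npath) : npath_edges u = npath_edges v -> u = v.
Proof.
case: u v => [s s0 ws] [t t0 wt] /= st; subst t.
by rewrite (Prop_irrelevance s0 t0) (Prop_irrelevance ws wt).
Qed.

Lemma sq_edge_inj (a b : sq_edge) : sqe_l a = sqe_l b ->
  sqe_cell a = sqe_cell b -> sqe_r a = sqe_r b -> a = b.
Proof.
case: a b => [p f q w] [p' f' q' w'] /= pp' ff' qq'; subst p' f' q'.
by rewrite (Prop_irrelevance w w').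
Qed.

Lemma one_path_bot p f q :
  one_path (p ++ top f ++ q) -> one_path (p ++ @bot K f ++ q).
Proof.
move=> [x [y w]]; exists x, y; have [u [v [wt wb]]] := top_bot f.
exact: walk_swap (@top_neq0 K f) wt wb w.
Qed.

Lemma cat_mid_neq0 (T : Type) (s1 t s2 : seq T) :
  t <> [::] -> s1 ++ t ++ s2 <> [::].
Proof. by case: s1 t => [|? ?] [|? ?]. Qed.

Definition sqe_ini (a : sq_edge) : npath :=
  @NPath (sqe_l a ++ top (sqe_cell a) ++ sqe_r a)
        (cat_mid_neq0 (@top_neq0 K (sqe_cell a)))
        (sqe_path a).

Definition sqe_ter (a : sq_edge) : npath :=
  @NPath (sqe_l a ++ bot (sqe_cell a) ++ sqe_r a)
        (cat_mid_neq0 (@bot_neq0 K (sqe_cell a)))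
        (one_path_bot (sqe_path a)).

Lemma sqe_inv_path (a : sq_edge) :
  one_path (sqe_l a ++ top (dinv (sqe_cell a)) ++ sqe_r a).
Proof. by rewrite top_inv; apply: one_path_bot (sqe_path a). Qed.

Definition sqe_inv (a : sq_edge) : sq_edge := SqEdge (sqe_inv_path a).

Lemma sqe_ini_inv a : sqe_ini (sqe_inv a) = sqe_ter a.
Proof. by apply: npath_inj; rewrite /= top_inv. Qed.

Lemma sqe_invK : involutive sqe_inv.
Proof. by move=> a; apply: sq_edge_inj; rewrite //= dinvK. Qed.

Lemma sqe_inv_neq a : sqe_inv a <> a.
Proof. by move/(congr1 sqe_cell); apply: dinv_neq. Qed.

Section FaceBoundary.
Variable c : sq_face.
Let p := sqf_l c.
Let f := sqf_cell1 c.
Let q := sqf_m c.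
Let g := sqf_cell2 c.
Let r := sqf_r c.

Lemma sqf_path2 : one_path ((p ++ bot f ++ q) ++ top g ++ r).
Proof. by rewrite -!catA; apply: one_path_bot (sqf_path c). Qed.

Lemma sqf_path4 : one_path ((p ++ top f ++ q) ++ top g ++ r).
Proof. by rewrite -!catA; apply: sqf_path. Qed.

Lemma sqf_path3 : one_path (p ++ top f ++ q ++ bot g ++ r).
Proof. by have := one_path_bot sqf_path4; rewrite -!catA. Qed.

Definition sqf_edge1 : sq_edge :=
  @SqEdge p f (q ++ top g ++ r) (sqf_path c).
Definition sqf_edge2 : sq_edge := @SqEdge (p ++ bot f ++ q) g r sqf_path2.
Definition sqf_edge3 : sq_edge := @SqEdge p f (q ++ bot g ++ r) sqf_path3.
Definition sqf_edge4 : sq_edge := @SqEdge (p ++ top f ++ q) g r sqf_path4.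

Definition sq_boundary : seq sq_edge :=
  [:: sqf_edge1; sqf_edge2; sqe_inv sqf_edge3; sqe_inv sqf_edge4].

Lemma sq_boundary_loop :
  exists x, walk sqe_ini sqe_ter x sq_boundary x.
Proof.
exists (sqe_ini sqf_edge1) => /=.
by do !split; apply: npath_inj; rewrite /= ?top_inv ?bot_inv -?catA.
Qed.

End FaceBoundary.

Definition squier : complex2 :=
  Complex2 sqe_ini_inv sqe_invK sqe_inv_neq sq_boundary_loop.

End Squier.

Definition diagram_group (K : dcomplex2) (w : npath K) : groupType :=
  @pi1 (squier K) w.

(* Main.v *)
(* Let every edge of a 1-path occupy a unit interval. Replacing a top path by a
   bottom path stretches one interval affinely and translates what is to its
   right, so loops at w act on [0, |w|] by piecewise affine homeomorphisms; these
   are ordered by comparing them just after the first point where they differ.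
   An edge (p, f, q) of a path starting at w also determines a letter: the cell f
   (up to inversion) with the chart of the subinterval of [0, |w|] that it
   occupies. Moves at disjoint intervals commute, so a path gives a signed word
   in the right-angled Artin group on the letters, where two letters commute when
   their intervals have disjoint interiors. Together, homeomorphism and word form
   a homomorphism to a semidirect product. It is injective: if the word is not
   reduced, a cell can be moved along squares until it meets its inverse, and the
   loop can be shortened.
   The Artin group is ordered by the Magnus expansion a |-> 1 + a in the ring of
   partially commuting letters with a ^ 2 = 0: one looks at the sign of the first
   nonzero coefficient of positive degree. The shortlex order on words comes from
   an order on letters that the homeomorphisms preserve, hence the order on the
   Artin group is preserved too and extends to the semidirect product. *)
From HB Require Import structures.
Require Import Defs.
From mathcomp Require Import all_boot all_order all_algebra zify ring lra wochoice.

Set Implicit Arguments.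
Unset Strict Implicit.
Unset Printing Implicit Defensive.

Import GRing.Theory Num.Theory Order.Theory.
Local Open Scope ring_scope.

(** * Magnus expansions of partially commutative words *)

Section TraceFunctions.
Variables (A : eqType) (comm : rel A).
Hypothesis comm_sym : symmetric comm.

(** These are the linear functionals on the ring in which letters related by [comm] commute and
    squares of letters vanish. *)
Definition tracelike (phi : seq A -> int) : Prop :=
  (forall u a b v, comm a b -> phi (u ++ a :: b :: v) = phi (u ++ b :: a :: v)) /\
  (forall u a v, phi (u ++ a :: a :: v) = 0).

Definition homog n (phi : seq A -> int) : Prop :=
  forall m, size m <> n -> phi m = 0.

Definition sgn (s : bool) : int := if s then 1 else -1.

(* The coefficient functional of the Magnus expansion [a |-> 1 + a] of a signed
   word, in the ring where commuting letters commute and [a ^ 2 = 0], so that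
   the inverse of [1 + a] is [1 - a]: a function [phi] of words is summed, with
   signs, over the subsequences of the word. *)
Fixpoint ev (W : seq (A * bool)) (phi : seq A -> int) : int :=
  if W is (a, s) :: W' then
    ev W' phi + sgn s * ev W' (fun m => phi (a :: m))
  else phi [::].

Fixpoint subs (W : seq (A * bool)) : seq (seq A) :=
  if W is (a, s) :: W' then subs W' ++ map (cons a) (subs W') else [:: [::]].

Lemma ev_ext W phi psi : (forall m, phi m = psi m) -> ev W phi = ev W psi.
Proof.
elim: W phi psi => [|[a s] W IH] phi psi E /=; first exact: E.
by rewrite (IH _ psi E); congr (_ + _ * _); apply: IH => m; apply: E.
Qed.

Lemma evD W phi psi : ev W (fun m => phi m + psi m) = ev W phi + ev W psi.
Proof.
elim: W phi psi => [|[a s] W IH] phi psi //=.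
by rewrite !IH; ring.
Qed.

Lemma evZ W c phi : ev W (fun m => c * phi m) = c * ev W phi.
Proof.
elim: W phi => [|[a s] W IH] phi //=.
by rewrite !IH; ring.
Qed.

Lemma ev_cat W1 W2 phi :
  ev (W1 ++ W2) phi = ev W1 (fun m => ev W2 (fun m' => phi (m ++ m'))).
Proof.
by elim: W1 phi => [|[a s] W IH] phi //=; rewrite !IH.
Qed.

Lemma ev_eq0 W phi : (forall m, phi m = 0) -> ev W phi = 0.
Proof.
by move=> E; rewrite (@ev_ext _ _ (fun m => 0 * phi m)) ?evZ ?mul0r // => m; rewrite E.
Qed.

Lemma ev_subs0 W phi : (forall m, m \in subs W -> phi m = 0) -> ev W phi = 0.
Proof.
elim: W phi => [|[a s] W IH] phi /= E; first by apply: E; rewrite inE.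
rewrite !IH ?mulr0 ?addr0 // => m mW; apply: E; rewrite mem_cat.
  by rewrite map_f ?orbT.
by rewrite mW.
Qed.

Lemma ev0 W phi : homog 0 phi -> ev W phi = phi [::].
Proof.
elim: W phi => [|[a s] W IH] phi h //=.
by rewrite IH // ev_eq0 ?mulr0 ?addr0 // => m; apply: h.
Qed.

Lemma tracelike_prefix phi m :
  tracelike phi -> tracelike (fun m' => phi (m ++ m')).
Proof. by case=> h1 h2; split=> [u a b v c|u a v]; rewrite !catA ?(h1 _ a b) ?h2. Qed.

Lemma tracelike_cons phi a : tracelike phi -> tracelike (fun m => phi (a :: m)).
Proof. exact: (@tracelike_prefix phi [:: a]). Qed.

Lemma tracelikeD phi psi : tracelike phi -> tracelike psi ->
  tracelike (fun m => phi m + psi m).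
Proof.
case=> h1 h2 [k1 k2]; split=> [u a b v c|u a v]; last by rewrite h2 k2.
by rewrite (h1 _ a b) ?(k1 _ a b).
Qed.

Lemma tracelikeZ phi c : tracelike phi -> tracelike (fun m => c * phi m).
Proof.
case=> h1 h2; split=> [u a b v k|u a v]; last by rewrite h2 mulr0.
by rewrite (h1 _ a b).
Qed.

Lemma tracelike_ev W phi : tracelike phi ->
  tracelike (fun m => ev W (fun m' => phi (m ++ m'))).
Proof.
case=> h1 h2; split=> [u a b v c|u a v].
  by apply: ev_ext => m; rewrite -!catA /= (h1 _ a b).
by apply: ev_eq0 => m; rewrite -catA /= h2.
Qed.

(** The Magnus expansion of [W] is 1. *)
Definition trivial_word W := forall phi, tracelike phi -> ev W phi = phi [::].

Lemma ev_insert U T V phi : trivial_word T -> tracelike phi ->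
  ev (U ++ T ++ V) phi = ev (U ++ V) phi.
Proof.
move=> tT tphi; rewrite ev_cat [RHS]ev_cat; apply: ev_ext => m.
rewrite ev_cat; exact: tT (tracelike_ev V (tracelike_prefix m tphi)).
Qed.

Lemma trivial_backtrack a s : trivial_word [:: (a, s); (a, ~~ s)].
Proof.
move=> phi [_ h]; rewrite /= (h [::] a [::]) /sgn.
by case: s => /=; ring.
Qed.

(** Since [a] and [b] commute, every term that repeats a letter sorts to one with a square and
    vanishes. Only the coefficients of 1, [a], [b] and [ab] have to be computed. *)
Lemma trivial_commutator a b s t : comm a b ->
  trivial_word [:: (a, s); (b, t); (a, ~~ s); (b, ~~ t)].
Proof.
move=> c phi [k h]; have ca : comm b a by rewrite comm_sym.
have aa v : phi (a :: a :: v) = 0 := h [::] a v.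
have bb v : phi (b :: b :: v) = 0 := h [::] b v.
have abb : phi [:: a; b; b] = 0 := h [:: a] b [::].
have ba : phi [:: b; a] = phi [:: a; b] := k [::] b a [::] ca.
have aba : phi [:: a; b; a] = 0 by rewrite (k [::] a b [:: a] c) (h [:: b]).
have bab : phi [:: b; a; b] = 0 by rewrite (k [::] b a [:: b] ca).
have abab : phi [:: a; b; a; b] = 0 by rewrite (k [:: a] b a [:: b] ca) aa.
by rewrite /= !(aa, bb) ba abb aba bab abab; case: s; case: t => /=; ring.
Qed.

Inductive swap : seq A -> seq A -> Prop :=
| Swap u a b v : comm a b -> swap (u ++ a :: b :: v) (u ++ b :: a :: v).

Definition trace_eq := clos_refl_sym_trans _ swap.

Lemma trace_eq_perm m m' : trace_eq m m' -> perm_eq m m'.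
Proof.
elim=> {m m'} [_ _ [u a b v _]|m|m m' _|m m' m'' _ h _]; last exact: perm_trans.
- by rewrite perm_cat2l -(cat1s a) -(cat1s b v) perm_catCA.
- exact: perm_refl.
- by rewrite perm_sym.
Qed.

Lemma tracelike_eq phi m m' : tracelike phi -> trace_eq m m' -> phi m = phi m'.
Proof.
case=> h1 h2; elim=> {m m'} [_ _ [u a b v c]|m|m m' _ ->|m m' m'' _ -> _ ->] //.
exact: h1.
Qed.

Definition square_trace m := exists u a v, trace_eq m (u ++ a :: a :: v).

(** The functional that reads off the coefficient of the monomial [m]. It is zero when [m] vanishes
    in the ring. *)
Definition trace_ind m : seq A -> int :=
  fun m' => if `[< trace_eq m m' /\ ~ square_trace m >] then 1 else 0.

Lemma trace_indT m m' : trace_eq m m' -> ~ square_trace m -> trace_ind m m' = 1.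
Proof. by move=> e s; rewrite /trace_ind asboolT. Qed.

Lemma trace_indF m m' : ~ trace_eq m m' -> trace_ind m m' = 0.
Proof. by move=> e; rewrite /trace_ind asboolF // => -[]. Qed.

Lemma tracelike_ind m : tracelike (trace_ind m).
Proof.
split=> [u a b v c|u a v]; rewrite /trace_ind; last first.
  by rewrite asboolF // => -[e []]; exists u, a, v.
have e : trace_eq (u ++ a :: b :: v) (u ++ b :: a :: v) by apply: rst_step; split.
congr (if _ then _ else _); apply: asbool_equiv_eq; split=> -[h s]; split=> //.
  exact: rst_trans e.
by apply: rst_trans (h) _; apply: rst_sym.
Qed.

Lemma homog_ind m : homog (size m) (trace_ind m).
Proof. by move=> m' s; apply: trace_indF => /trace_eq_perm/perm_size e; case: s. Qed.

Lemma square_trace0 phi m : tracelike phi -> square_trace m -> phi m = 0.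
Proof.
move=> t [u [a [v e]]]; rewrite (tracelike_eq t e); by case: t.
Qed.

(** On the finitely many subsequences of [W], [phi] agrees with a linear combination of the
    coefficient functionals of degree [n]. *)
Lemma ev_span W n phi :
  (forall m, size m = n -> ev W (trace_ind m) = 0) ->
  tracelike phi -> homog n phi -> ev W phi = 0.
Proof.
move=> W0; have : forall m, m \in subs W -> phi m <> 0 -> m \in subs W by [].
(* [L] contains the subsequences of [W] at which [phi] is nonzero. Subtracting [phi m * trace_ind m]
   allows [m] to be dropped from it. *)
move: {-1}(subs W) => L; elim: L phi => [|m L IH] phi hL tphi hphi.
  by apply: ev_subs0 => m mW; apply: contrapT => /(hL _ mW).
have [/eqP p0|/eqP p0] := boolP (phi m == 0).
  apply: IH => // m' m'W p'; have := hL _ m'W p'; rewrite inE => /orP[/eqP e|//].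
  by rewrite e in p'.
have sm : size m = n by apply: contrapT => /hphi.
have nsq : ~ square_trace m by move=> /(square_trace0 tphi).
pose psi m' := phi m' + - phi m * trace_ind m m'.
have : ev W psi = 0.
  apply: IH => [m' m'W p'||m' s].
  - have [e|ne] := pselect (trace_eq m m').
      case: p'; rewrite /psi trace_indT // (tracelike_eq tphi e); ring.
    rewrite /psi trace_indF // mulr0 addr0 in p'.
    have := hL _ m'W p'; rewrite inE => /orP[/eqP e|//].
    by case: ne; rewrite e; apply: rst_refl.
  - by apply: tracelikeD => //; apply: tracelikeZ; apply: tracelike_ind.
  - by rewrite /psi hphi // homog_ind ?sm // mulr0 addr0.
by rewrite /psi evD evZ W0 // mulr0 addr0.
Qed.

(** The expansion of [W] is 1 plus terms of degree at least [n]. *)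
Definition deep n W := forall m, (0 < size m < n)%N -> ev W (trace_ind m) = 0.

Definition restr (P : pred nat) (phi : seq A -> int) m :=
  if P (size m) then phi m else 0.

Lemma size_swap (u v : seq A) a b :
  size (u ++ a :: b :: v) = size (u ++ b :: a :: v).
Proof. by rewrite !size_cat. Qed.

Lemma tracelike_restr P phi : tracelike phi -> tracelike (restr P phi).
Proof.
case=> h1 h2; rewrite /restr; split=> [u a b v c|u a v].
  by rewrite size_swap (h1 _ a b).
by rewrite h2; case: ifP.
Qed.

(** Degrees strictly between 0 and [n] contribute nothing by [ev_span], and those above [n] are
    killed by [phi]. *)
Lemma ev_deep n W phi : deep n W -> (0 < n)%N -> tracelike phi ->
  (forall m, (n < size m)%N -> phi m = 0) ->
  ev W phi = phi [::] + ev W (restr (pred1 n) phi).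
Proof.
move=> dW n0 tphi hphi.
have low k : (k < n)%N -> ev W (restr (fun i => i <= k)%N phi) = phi [::].
  elim: k => [_|k IH kn].
    by rewrite ev0 // => -[|a m] // _; rewrite /restr.
  rewrite -(IH (ltnW kn)) (@ev_ext _ _ (fun m => restr (fun i => i <= k)%N phi m
    + restr (pred1 k.+1) phi m)).
    rewrite evD (@ev_span W k.+1 (restr (pred1 k.+1) phi)) ?addr0 //.
    - by move=> m sm; apply: dW; rewrite sm.
    - exact: tracelike_restr.
    - by move=> m /eqP/negbTE; rewrite /restr /= => ->.
  by move=> m; rewrite /restr /= -[(_ <= k)%N]ltnS; case: ltngtP; rewrite ?addr0 ?add0r.
case: n n0 dW hphi low => // n _ dW hphi low.
rewrite -(low n) // -evD; apply: ev_ext => m; rewrite /restr /=.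
have [h|h|h] := ltngtP (size m) n.+1.
- by rewrite -ltnS h addr0.
- by rewrite hphi //; case: ifP; rewrite ?addr0.
- by rewrite h ltnn add0r.
Qed.

(* The lowest nonconstant homogeneous part of an expansion is not affected by
   what surrounds it. *)
Lemma ev_mid n U W V phi : deep n W -> (0 < n)%N -> tracelike phi -> homog n phi ->
  ev (U ++ W ++ V) phi = ev (U ++ V) phi + ev W phi.
Proof.
move=> dW n0 tphi hphi; rewrite ev_cat.
(* [W] contributes only after the empty prefix: a nonempty [m] leaves fewer than [n] letters for
   [W]. *)
pose delta (m : seq A) := (ev W phi) * (m == [::])%:R.
rewrite (@ev_ext _ _ (fun m => ev V (fun m' => phi (m ++ m')) + delta m)); last first.
  move=> m; rewrite ev_cat (@ev_deep n) //.
  - congr (_ + _); rewrite /delta; case: eqP => [->|/eqP m0].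
      rewrite mulr1; apply: ev_ext => m'; rewrite /restr /=; case: eqP => [s|/hphi //].
      rewrite ev0 ?cats0 // => m'' s''; apply: hphi; rewrite size_cat s.
      by move=> h; apply: s''; lia.
    rewrite mulr0 ev_eq0 // => m'.
    rewrite /restr /=; case: eqP => // s; apply: ev_eq0 => m''.
    apply: hphi; rewrite !size_cat s; case: m m0 => //= a m _; lia.
  - exact: (tracelike_ev V (tracelike_prefix m tphi)).
  - by move=> m' s; apply: ev_eq0 => m''; apply: hphi; rewrite !size_cat; lia.
rewrite evD -ev_cat (@ev0 U delta) /delta ?mulr1 //.
by case=> // a m _; rewrite mulr0.
Qed.

End TraceFunctions.

Lemma ev_map (A B : eqType) (h : B -> A) (W : seq (B * bool)) phi :
  ev [seq (h x.1, x.2) | x <- W] phi = ev W (fun m => phi (map h m)).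
Proof. by elim: W phi => [|[a s] W IH] phi //=; rewrite !IH. Qed.

(** * Reduced words have nontrivial expansions *)

Section Reduced.
Variables (A : eqType) (comm : rel A).
Hypothesis comm_sym : symmetric comm.

Local Notation trace_eq := (trace_eq comm).
Local Notation square_trace := (square_trace comm).
Local Notation trace_ind := (trace_ind comm).
Local Notation tracelike := (tracelike comm).

Fixpoint starts a (m : seq A) : bool :=
  if m is b :: m' then (b == a) || comm a b && starts a m' else false.

Lemma starts_trace a m m' : trace_eq m m' -> starts a m = starts a m'.
Proof.
elim=> {m m'} [_ _ [u b c v bc]|//|m m' _ -> //|m m' m'' _ -> _ -> //].
elim: u => [|d u IH] /=; last by rewrite IH.
have [<-|nba] := eqVneq b a; first by rewrite bc orbT.
have [<-|nca] /= := eqVneq c a; first by rewrite comm_sym bc.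
by rewrite andbCA.
Qed.

Lemma trace_eq_cons a m m' : trace_eq m m' -> trace_eq (a :: m) (a :: m').
Proof.
elim=> {m m'} [_ _ [u b c v bc]|m|m m' _ h|m m' m'' _ h1 _ h2].
- exact: (rst_step _ _ _ _ (Swap (a :: u) v bc)).
- exact: rst_refl.
- exact: rst_sym.
- exact: rst_trans h2.
Qed.

Lemma trace_eq_rem a m m' : trace_eq m m' -> trace_eq (rem a m) (rem a m').
Proof.
elim=> {m m'} [_ _ [u b c v bc]|m|m m' _ h|m m' m'' _ h1 _ h2].
- elim: u => [|d u IH] /=.
    have [E|nba] := eqVneq b a; have [E'|nca] := eqVneq c a; subst;
      rewrite ?eqxx ?(negbTE nca) ?(negbTE nba) /=; try exact: rst_refl.
    exact: (rst_step _ _ _ _ (Swap [::] _ bc)).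
  case: eqP => [_|_]; first exact: (rst_step _ _ _ _ (Swap u v bc)).
  exact: trace_eq_cons.
- exact: rst_refl.
- exact: rst_sym.
- exact: rst_trans h2.
Qed.

Lemma square_cons a m : square_trace m -> square_trace (a :: m).
Proof. by move=> [u [b [v e]]]; exists (a :: u), b, v; apply: trace_eq_cons. Qed.

(** Delete the first [a] from a word with a square. If the square is untouched, it survives in [m];
    otherwise the other [a] of the square can be moved to the front of [m]. *)
Lemma nonsquare_cons a m : ~ square_trace m -> ~~ starts a m ->
  ~ square_trace (a :: m).
Proof.
move=> nsq nst [u [b [v e]]].
have := trace_eq_rem a e; have := starts_trace a e; rewrite /= eqxx /=.
have [au _|au] := boolP (a \in u).
  have -> : rem a (u ++ b :: b :: v) = rem a u ++ b :: b :: v.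
    elim: u au {e} => //= d u IH; rewrite inE.
    by have [//|nda /= /IH ->] := eqVneq a d.
  by move=> e'; apply: nsq; exists (rem a u), b, v.
have -> : rem a (u ++ b :: b :: v) = u ++ rem a (b :: b :: v).
  elim: u au {e} => //= d u IH; rewrite inE negb_or eq_sym => /andP[/negbTE -> /IH ->] //.
have [E|nba] := eqVneq b a => /= /esym sa; subst.
  rewrite eqxx => e'; move: nst; rewrite (starts_trace a e'); apply/negP.
  elim: u au sa {e e'} => [|d u IH] /=; first by rewrite eqxx.
  rewrite inE negb_or eq_sym => /andP[/negbTE -> /IH {}IH] /= /andP[-> /IH ->] //.
move=> e'; apply: nsq; exists u, b, (rem a v).
by rewrite (negbTE nba) in e'.
Qed.

Lemma trace_ind_cons a m m' : ~ square_trace (a :: m) ->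
  trace_ind (a :: m) (a :: m') = trace_ind m m'.
Proof.
move=> nsq; have nsq' : ~ square_trace m by move=> /(square_cons a).
have [e|ne] := pselect (trace_eq m m').
  by rewrite !trace_indT //; apply: trace_eq_cons.
rewrite !trace_indF // => /(trace_eq_rem a); by rewrite /= eqxx.
Qed.

Fixpoint canc a s (W : seq (A * bool)) : bool :=
  if W is (b, t) :: W' then (b == a) && (t == ~~ s) || comm a b && canc a s W'
  else false.

Fixpoint reduced (W : seq (A * bool)) : bool :=
  if W is (a, s) :: W' then ~~ canc a s W' && reduced W' else true.

(* [stripk a W] is the total exponent of the occurrences of [a] that can be
   moved to the front of [W], and [stripw a W] is what is left of [W]. *)
Fixpoint stripk a (W : seq (A * bool)) : int :=
  if W is (b, s) :: W' then
    if b == a then sgn s + stripk a W' else if comm a b then stripk a W' else 0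
  else 0.

Fixpoint stripw a (W : seq (A * bool)) : seq (A * bool) :=
  if W is (b, s) :: W' then
    if b == a then stripw a W' else if comm a b then (b, s) :: stripw a W' else W
  else [::].

(** With [k = stripk a W], the occurrences of [a] brought to the front multiply to [1 + k a],
    because [a ^ 2 = 0]. *)
Lemma ev_strip a W phi : tracelike phi ->
  ev W phi = ev (stripw a W) phi + stripk a W * ev (stripw a W) (fun m => phi (a :: m)).
Proof.
elim: W phi => [|[b s] W IH] phi tphi /=; first by rewrite mul0r addr0.
have [E|nba] := eqVneq b a; first subst b.
  rewrite (IH phi) // (IH (fun m => phi (a :: m))); last exact: tracelike_cons.
  rewrite (@ev_eq0 _ (stripw a W) (fun m => phi (a :: a :: m))); first by ring.
  by move=> m; apply: (tphi.2 [::]).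
case: ifP => [ab|_] /=; last by rewrite mul0r addr0.
rewrite (IH phi) // (IH (fun m => phi (b :: m))); last exact: tracelike_cons.
rewrite (@ev_ext _ _ (fun m => phi (b :: a :: m)) (fun m => phi (a :: b :: m))).
  by ring.
by move=> m; apply: (tphi.1 [::]); rewrite comm_sym.
Qed.

Lemma starts_strip a W : ~~ starts a (map fst (stripw a W)).
Proof.
elim: W => //= -[b s] W IH; have [//|nba] := eqVneq b a.
by case: ifP => /= ab; rewrite ?ab (negbTE nba).
Qed.

Lemma starts_of_strip a b W : comm a b -> starts b (map fst (stripw a W)) ->
  starts b (map fst W).
Proof.
move=> ab; elim: W => //= -[c s] W IH /=.
have [-> /IH ->|nca] := eqVneq c a; first by rewrite comm_sym ab orbT.
by case: ifP => //= ac /orP[->//|/andP[-> /IH ->]]; rewrite orbT.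
Qed.

(** In a reduced word the occurrences of [a] that reach the front all carry one sign, and this sign
    is [s] because none of them cancels [(a, s)]. *)
Lemma stripk_sign a s W : reduced W -> ~~ canc a s W -> 0 <= sgn s * stripk a W.
Proof.
elim: W => [|[b t] W IH] /=; first by rewrite mulr0.
move=> /andP[nc rW]; have [E|nba] /= := eqVneq b a.
  subst b; rewrite negb_or => /andP[ts _].
  have Ets : t = s by case: (t) (s) ts => -[].
  subst t; rewrite mulrDr; have := IH rW nc; rewrite /sgn; case: (s); lia.
by case: ifP => /= [_ /(IH rW)//|]; rewrite mulr0.
Qed.

Lemma canc_of_strip a b t W : comm a b -> canc b t (stripw a W) -> canc b t W.
Proof.
move=> ab; elim: W => //= -[c s] W IH /=.
have [-> /IH ->|nca] := eqVneq c a; first by rewrite comm_sym ab orbT.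
by case: ifP => //= ac /orP[->//|/andP[-> /IH ->]]; rewrite orbT.
Qed.

Lemma reduced_strip a W : reduced W -> reduced (stripw a W).
Proof.
elim: W => //= -[b s] W IH /andP[nc rW].
case: eqP => [_|_]; first exact: IH.
case: ifP => ab /=; last by rewrite nc.
rewrite IH // andbT; apply: contra nc; exact: canc_of_strip.
Qed.

Lemma size_stripw a W : (size (stripw a W) <= size W)%N.
Proof.
elim: W => //= -[b s] W IH; case: ifP => _; first exact: leqW.
by case: ifP.
Qed.

(* The word [m] collects one letter from each class of equal letters of [W]
   that can be brought together; it has maximal degree in the expansion. *)
Lemma reduced_witness W : reduced W -> exists m,
  [/\ ~ square_trace m, forall b, starts b m -> starts b (map fst W),
      ev W (trace_ind m) <> 0, W <> [::] -> m <> [::]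
    & forall phi, tracelike phi ->
        (forall m', (size m' <= size m)%N -> phi m' = 0) -> ev W phi = 0].
Proof.
have [n] := ubnP (size W); elim: n W => // n IH [|[a s] W] /= sW.
  move=> _; have nsq : ~ square_trace [::].
    by move=> [u [b [v /trace_eq_perm/perm_size]]]; rewrite size_cat /= !addnS.
  exists [::]; split=> //; first by rewrite trace_indT //; apply: rst_refl.
  by move=> phi _; apply.
move=> /andP[nc rW]; have [|m [nsq st em _ top]] := IH _ _ (reduced_strip a rW).
  by rewrite (leq_ltn_trans (size_stripw a W)).
have nst : ~~ starts a m.
  by apply/negP => /st; apply/negP; apply: starts_strip.
have nsq' := nonsquare_cons nsq nst.
have evE phi : tracelike phi -> ev ((a, s) :: W) phi = ev (stripw a W) phi +
    (sgn s + stripk a W) * ev (stripw a W) (fun m => phi (a :: m)).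
  by move=> /(ev_strip a ((a, s) :: W)) -> /=; rewrite eqxx.
exists (a :: m); split=> //.
- move=> b /=; case: eqP => //= _ /andP[ba /st]; rewrite ba.
  by apply: starts_of_strip; rewrite comm_sym.
- have := evE _ (tracelike_ind comm (a :: m)); rewrite /= => ->.
  (* [a :: m] is longer than the maximal degree [size m] of the stripped word. *)
  have -> : ev (stripw a W) (trace_ind (a :: m)) = 0.
    apply: top => [|m' le]; first exact: tracelike_ind.
    by apply: homog_ind => E; move: le; rewrite E /= ltnn.
  rewrite add0r (@ev_ext _ _ _ (trace_ind m)) => [|m']; last exact: trace_ind_cons.
  (* The factor [sgn s + stripk a W] is nonzero because its summands do not have opposite signs. *)
  apply/eqP; rewrite mulf_eq0 negb_or; apply/andP; split; last exact/eqP.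
  by have := stripk_sign rW nc; rewrite /sgn; case: (s); lia.
- move=> phi tphi hphi; have := evE _ tphi; rewrite /= => ->.
  rewrite !top ?mulr0 ?addr0 //.
  + exact: tracelike_cons.
  + by move=> m' le; apply: hphi.
  + by move=> m' le; apply: hphi; apply: leq_trans le _.
Qed.

End Reduced.

(** * Positive words *)

Definition strict_total (T : Type) (lt : T -> T -> Prop) : Prop :=
  [/\ forall x, ~ lt x x, forall x y z, lt x y -> lt y z -> lt x z
    & forall x y, x <> y -> lt x y \/ lt y x].

Section WordOrder.
Variables (A : eqType) (lt : A -> A -> Prop).
Hypothesis lt_total : strict_total lt.

Fixpoint lexlt (m m' : seq A) : Prop :=
  match m, m' with
  | a :: m1, b :: m1' => lt a b \/ a = b /\ lexlt m1 m1'
  | _, _ => False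
  end.

Definition wlt (m m' : seq A) : Prop :=
  (size m < size m')%N \/ size m = size m' /\ lexlt m m'.

Lemma wlt_strict_total : strict_total wlt.
Proof.
have [irr tr tot] := lt_total; split.
- move=> m [|[_]]; first by rewrite ltnn.
  by elim: m => //= a m IH [/irr|[_ /IH]].
- move=> m1 m2 m3 [s12|[s12 l12]] [s23|[s23 l23]]; try (left; lia).
  right; split; first by rewrite s12.
  elim: m1 m2 m3 l12 l23 {s12 s23} => [|a m1 IH] [|b m2] [|c m3] //=.
  move=> [ab|[-> l12]] [bc|[E l23]]; try (by left; rewrite -?E //; apply: tr bc).
  by right; split=> //; apply: IH l23.
- move=> m m' mm'; have [s|s|s] := ltngtP (size m) (size m').
  + by left; left.
  + by right; left.
  + suff [l|l] : lexlt m m' \/ lexlt m' m by [left; right|right; right].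
    elim: m m' s mm' => [|a m IH] [|b m'] //= [s] mm'.
    have [E|/tot[l|l]] := pselect (a = b); [|by left; left|by right; left].
    subst b; have [|l|l] := IH m' s; first by move=> E; apply: mm'; rewrite E.
      by left; right.
    by right; right.
Qed.

(** The order on letters is arbitrary, so shortlex need not be well-founded; least words are
    therefore sought in a finite list. *)
Lemma strict_least (T : eqType) (R : T -> T -> Prop) (P : T -> Prop) (L : seq T) :
  strict_total R -> (exists2 m, m \in L & P m) ->
  exists m, P m /\ forall m', m' \in L -> P m' -> ~ R m' m.
Proof.
move=> [irr tr _]; elim: L => [[m]//|x L IH] [m]; rewrite inE => mL Pm.
have [/IH[m1 [P1 l1]]|no] := pselect (exists2 m, m \in L & P m); last first.
  move: mL => /orP[/eqP E|mL]; last by case: no; exists m.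
  subst x; exists m; split=> //.
  by move=> m'; rewrite inE => /orP[/eqP -> _|m'L Pm'];
    [exact: irr|case: no; exists m'].
have [[Px xm1]|nx] := pselect (P x /\ R x m1).
  exists x; split=> // m'; rewrite inE => /orP[/eqP -> _|m'L Pm' h]; first exact: irr.
  by apply: (l1 m') => //; apply: tr xm1.
by exists m1; split=> // m'; rewrite inE => /orP[/eqP -> Px h|]; [case: nx|exact: l1].
Qed.

End WordOrder.

Section Positive.
Variables (A : eqType) (comm : rel A) (lt : A -> A -> Prop).
Hypothesis lt_total : strict_total lt.

Local Notation trace_ind := (trace_ind comm).
Local Notation wlt := (wlt lt).
Local Notation trivial_word := (trivial_word comm).

(** Words are compared rather than traces. Equivalent words have the same coefficient, so [m] is the
    least representative of the leading monomial. *)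
Definition positive (W : seq (A * bool)) : Prop := exists m,
  [/\ m <> [::], 0 < ev W (trace_ind m)
    & forall m', m' <> [::] -> wlt m' m -> ev W (trace_ind m') = 0].

Lemma ev_trivial W m : trivial_word W -> m <> [::] -> ev W (trace_ind m) = 0.
Proof.
move=> tW m0; rewrite tW; last exact: tracelike_ind.
by apply: (@homog_ind _ comm) => /esym/size0nil.
Qed.

Lemma least_deep W m :
  (forall m', m' <> [::] -> wlt m' m -> ev W (trace_ind m') = 0) ->
  deep comm (size m) W.
Proof. by move=> h m' /andP[m'0 s]; apply: h; [case: m' m'0 {s}|left]. Qed.

Lemma ev_mid_ind U W V m k : deep comm k W -> m <> [::] -> (size m <= k)%N ->
  ev (U ++ W ++ V) (trace_ind m) = ev (U ++ V) (trace_ind m) + ev W (trace_ind m).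
Proof.
move=> dW m0 mk; apply: (@ev_mid _ comm (size m)).
- by move=> m' /andP[m'0 s]; apply: dW; rewrite m'0 (leq_trans s).
- by case: (m) m0.
- exact: tracelike_ind.
- exact: homog_ind.
Qed.

Lemma wlt_size m m' : wlt m m' -> (size m <= size m')%N.
Proof. by case=> [/ltnW|[-> _]]. Qed.

Lemma positive_trivial W : trivial_word W -> ~ positive W.
Proof. by move=> tW [m [m0]]; rewrite (ev_trivial tW m0) ltxx. Qed.

(** Up to degree [size m] the context only adds the coefficients of the trivial word [U ++ V]. This
    yields invariance under conjugation. *)
Lemma positive_sandwich U W V : trivial_word (U ++ V) -> positive W ->
  positive (U ++ W ++ V).
Proof.
move=> tUV [m [m0 p l]]; have dW := least_deep l.
have E m' : m' <> [::] -> (size m' <= size m)%N ->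
    ev (U ++ W ++ V) (trace_ind m') = ev W (trace_ind m').
  move=> m'0 s; rewrite (ev_mid_ind _ _ dW m'0 s).
    by rewrite (ev_trivial tUV) // add0r.
exists m; rewrite E //; split=> // m' m'0 lm; rewrite E //; first exact: l.
exact: wlt_size.
Qed.

(** Up to the degree of the leading word of [W2] the coefficients add, so the leading term of the
    product is the smaller of the two leading terms, or their sum if the words coincide. *)
Lemma positive_cat W1 W2 : positive W1 -> positive W2 -> positive (W1 ++ W2).
Proof.
have [_ tr tot] := wlt_strict_total lt_total.
move=> [m1 [m10 p1 l1]] [m2 [m20 p2 l2]].
have E m' : m' <> [::] -> (size m' <= size m2)%N -> ev (W1 ++ W2) (trace_ind m') =
    ev W1 (trace_ind m') + ev W2 (trace_ind m').
  move=> m'0 s; have := @ev_mid_ind W1 W2 [::] m' _ (least_deep l2) m'0 s.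
  by rewrite !cats0.
have [E12|/tot[l12|l12]] := pselect (m1 = m2).
- subst m2; exists m1; rewrite E //; split=> // [|m' m'0 l]; first exact: addr_gt0.
  by rewrite E ?(wlt_size l) // l1 // l2.
- exists m1; rewrite E ?(wlt_size l12) //; split=> // [|m' m'0 l].
    by rewrite (l2 _ _ l12) ?addr0.
  have l' := tr _ _ _ l l12.
  by rewrite E ?(wlt_size l') // l1 // l2.
- exists m2; rewrite E //; split=> // [|m' m'0 l].
    by rewrite (l1 _ _ l12) ?add0r.
  have l' := tr _ _ _ l l12.
  by rewrite E ?(wlt_size l) // l1 // l2.
Qed.

(** Equivalent words are permutations of each other, so the nonzero coefficients lie on a finite
    list, from which a first one can be picked. *)
Lemma ev_support W m : ev W (trace_ind m) <> 0 ->
  m \in flatten [seq permutations s | s <- subs W].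
Proof.
move=> h; have [s sW sm] : exists2 s, s \in subs W & trace_ind m s <> 0.
  apply: contrapT => no; apply: h; apply: ev_subs0 => s sW.
  by apply: contrapT => h; apply: no; exists s.
have {sm} ms : trace_eq comm m s by apply: contrapT => /trace_indF.
apply/flattenP; exists (permutations s); first exact: map_f.
by rewrite mem_permutations; apply: trace_eq_perm ms.
Qed.

(** Up to the lowest positive degree in which [W] has a nonzero coefficient, the coefficients of
    [W'] are the negatives of those of [W]. *)
Lemma positive_total W W' m : m <> [::] -> ev W (trace_ind m) <> 0 ->
  trivial_word (W ++ W') -> positive W \/ positive W'.
Proof.
move=> m0 em tWW'.
have [m1 [[m10 em1] l1]] := @strict_least _ wlt
  (fun m => m <> [::] /\ ev W (trace_ind m) <> 0)
  _ (wlt_strict_total lt_total) (ex_intro2 _ _ m (ev_support em) (conj m0 em)).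
have {}l1 m' : m' <> [::] -> wlt m' m1 -> ev W (trace_ind m') = 0.
  by move=> m'0 l; apply: contrapT => h; apply: (l1 m') => //; apply: ev_support.
have E m' : m' <> [::] -> (size m' <= size m1)%N ->
    ev W' (trace_ind m') = - ev W (trace_ind m').
  move=> m'0 s; apply/eqP; rewrite -addr_eq0; apply/eqP.
  have /= <- := @ev_mid_ind [::] W W' m' _ (least_deep l1) m'0 s.
  exact: ev_trivial.
have [p|p|//] := ltgtP (ev W (trace_ind m1)) 0; [right|left]; exists m1.
  rewrite E // oppr_gt0; split=> // m' m'0 l.
  by rewrite E ?l1 ?oppr0 // (wlt_size l).
by split.
Qed.

Section Relabel.
Variables h h' : A -> A.
Hypotheses (hK : cancel h h') (h'K : cancel h' h).
Hypothesis h_lt : forall a b, lt a b -> lt (h a) (h b).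
Hypothesis h_comm : forall a b, comm (h a) (h b) = comm a b.

Lemma trace_eq_map m m' : trace_eq comm m m' -> trace_eq comm (map h m) (map h m').
Proof.
elim=> {m m'} [_ _ [u b c v bc]|m|m m' _ e|m m' m'' _ h1 _ h2].
- rewrite !map_cat /=; apply: rst_step; split; by rewrite h_comm.
- exact: rst_refl.
- exact: rst_sym.
- exact: rst_trans h2.
Qed.

Lemma trivial_map W : trivial_word W -> trivial_word [seq (h x.1, x.2) | x <- W].
Proof.
move=> tW phi [t1 t2]; rewrite ev_map tW //; split=> [u a b v c|u a v].
  by rewrite !map_cat /= t1 ?h_comm.
by rewrite !map_cat /= t2.
Qed.

End Relabel.

Lemma trace_ind_map h h' m m' : cancel h h' -> cancel h' h ->
  (forall a b, comm (h a) (h b) = comm a b) ->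
  trace_ind (map h m) (map h m') = trace_ind m m'.
Proof.
move=> hK h'K hc; have hc' a b : comm (h' a) (h' b) = comm a b by rewrite -hc !h'K.
have e s t : trace_eq comm (map h s) t <-> trace_eq comm s (map h' t).
  split=> [/(trace_eq_map hc')|/(trace_eq_map hc)].
    by rewrite (mapK hK).
  by rewrite (mapK h'K).
have em : trace_eq comm (map h m) (map h m') <-> trace_eq comm m m'.
  by rewrite e (mapK hK).
have sm : square_trace comm (map h m) <-> square_trace comm m.
  split=> -[u [a [v E]]].
    exists (map h' u), (h' a), (map h' v); rewrite -!map_cons -map_cat; exact/e.
  exists (map h u), (h a), (map h v); rewrite -!map_cons -map_cat; apply/e.
  by rewrite (mapK hK).
congr (if _ then _ else _); apply: asbool_equiv_eq.
by split=> -[/em ? ?]; split=> //; rewrite ?sm // -?sm.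
Qed.

(** As the order is total, the inverse of an order-preserving bijection preserves it too, so leading
    words correspond. *)
Lemma positive_map h h' W : cancel h h' -> cancel h' h ->
  (forall a b, lt a b -> lt (h a) (h b)) ->
  (forall a b, comm (h a) (h b) = comm a b) ->
  positive W -> positive [seq (h x.1, x.2) | x <- W].
Proof.
have [irr tr tot] := lt_total.
move=> hK h'K hl hc [m [m0 p l]].
have hl' a b : lt a b -> lt (h' a) (h' b).
  move=> ab; have [E|/tot[//|/hl]] := pselect (h' a = h' b).
    by move: ab; rewrite -(h'K a) E h'K => /irr.
  by rewrite !h'K => /(tr _ _ _ ab)/irr.
have wl' s t : wlt s (map h t) -> wlt (map h' s) t.
  rewrite /wlt !size_map => -[?|[E lx]]; [by left|right; split=> //].
  elim: s t E lx => [|a s IH] [|b t] //= [E] [/hl'|[-> /(IH _ E)]].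
    by rewrite hK; left.
  by rewrite hK; right.
have E s : ev [seq (h x.1, x.2) | x <- W] (trace_ind (map h s)) = ev W (trace_ind s).
  by rewrite ev_map; apply: ev_ext => t; apply: trace_ind_map.
exists (map h m); split; [by case: (m) m0|by rewrite E|move=> m' m'0 /wl' lm].
rewrite -(mapK h'K m') E l //; by case: (m') m'0.
Qed.

Lemma positive_equiv W W' :
  (forall phi, tracelike comm phi -> ev W phi = ev W' phi) ->
  positive W -> positive W'.
Proof.
move=> E [m [m0 p l]]; exists m; split=> // [|m' m'0 lm].
  by rewrite -E //; apply: tracelike_ind.
by rewrite -E ?l //; apply: tracelike_ind.
Qed.

End Positive.

(** * Piecewise affine functions *)

(** A tree of subdivisions plays the role of a finite partition, so that proofs go by induction on
    it. *)
Inductive piecewise (P : rat -> rat -> Prop) : rat -> rat -> Prop :=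
| PwBase x y : P x y -> piecewise P x y
| PwCat x y z : x <= y -> y <= z -> piecewise P x y -> piecewise P y z ->
    piecewise P x z.

Definition hereditary (P : rat -> rat -> Prop) : Prop :=
  forall x y x' y', x <= x' -> y' <= y -> P x y -> P x' y'.

Definition affine_on (f : rat -> rat) (x y : rat) : Prop :=
  exists k c, forall t, x <= t <= y -> f t = k * t + c.

Lemma affine_hereditary f : hereditary (affine_on f).
Proof.
move=> x y x' y' xx yy [k [c h]]; exists k, c => t /andP[h1 h2].
by apply: h; rewrite (le_trans xx) // (le_trans h2).
Qed.

Lemma piecewise_sub P x y x' y' : hereditary P -> piecewise P x y ->
  x <= x' -> x' <= y' -> y' <= y -> piecewise P x' y'.
Proof.
move=> hP pw; elim: pw x' y' => {x y} [x y p|x y z xy yz _ IH1 _ IH2] x' y' xx xy' yy.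
  by apply: PwBase; apply: hP p.
have [y'y|yy'] := leP y' y; first exact: IH1.
have [yx'|x'y] := leP y x'; first exact: IH2.
by apply: (PwCat (y := y)); rewrite ?(ltW yy') ?(ltW x'y) //; [apply: IH1|apply: IH2];
  rewrite // ?(ltW yy') ?(ltW x'y).
Qed.

Lemma piecewise_and P Q x y : hereditary P -> hereditary Q -> x <= y ->
  piecewise P x y -> piecewise Q x y -> piecewise (fun s t => P s t /\ Q s t) x y.
Proof.
move=> hP hQ xy pw; elim: pw xy => {x y} [x y p|x y z xy yz _ IH1 _ IH2] xy'.
  move=> qw; elim: qw p {xy'} => {x y} [x y q|x y z xy yz _ IH1 _ IH2] p.
    exact: PwBase.
  by apply: (PwCat xy yz); [apply: IH1|apply: IH2]; apply: hP p.
move=> qw; apply: (PwCat xy yz); [apply: IH1|apply: IH2] => //;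
  exact: piecewise_sub qw _ _ _.
Qed.

Lemma piecewise_eq f g x y : (forall t, x <= t <= y -> f t = g t) ->
  piecewise (affine_on f) x y -> piecewise (affine_on g) x y.
Proof.
move=> fg pw; elim: pw fg => {x y} [x y [k [c h]]|x y z xy yz _ IH1 _ IH2] fg.
  by apply: PwBase; exists k, c => t ht; rewrite -fg ?h.
apply: (PwCat xy yz); [apply: IH1|apply: IH2] => t /andP[h1 h2]; apply: fg.
  by rewrite h1 (le_trans h2).
by rewrite h2 (le_trans xy).
Qed.

Lemma piecewise_comp_affine f k c a b : 0 < k -> piecewise (affine_on f) a b ->
  piecewise (affine_on (fun t => f (k * t + c))) ((a - c) / k) ((b - c) / k).
Proof.
move=> k0; elim=> {a b} [a b [k' [c' h]]|x y z xy yz _ IH1 _ IH2]; last first.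
  by apply: PwCat IH1 IH2; rewrite ler_pM2r ?invr_gt0 // lerD2r.
apply: PwBase; exists (k' * k), (k' * c + c') => t.
rewrite ler_pdivrMr // ler_pdivlMr // => ht.
by rewrite h; [ring|lra].
Qed.

Lemma piecewise_comp f g x y : x <= y ->
  (forall s t, s <= t -> piecewise (affine_on f) s t) ->
  (forall s t, x <= s -> s < t -> t <= y -> g s < g t) ->
  piecewise (affine_on g) x y -> piecewise (affine_on (f \o g)) x y.
Proof.
move=> xy pf gi pg; elim: pg xy gi => {x y} [x y [k [c h]]|x y z xy yz _ IH1 _ IH2] xz gi.
  (* A one-point piece is affine for trivial reasons; the slope of [g] is known to be positive only
     on a piece with two distinct ends. *)
  have [E|nxy] := eqVneq x y.
    apply: PwBase; exists 0, (f (g x)) => t; rewrite -E => ht.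
    have -> : t = x by lra.
    by rewrite /=; ring.
  have ltxy : x < y by rewrite lt_neqAle nxy.
  have gx := h x; have gy := h y; have gxy := gi x y (lexx _) ltxy (lexx _).
  rewrite !lexx xz /= in gx gy.
  have k0 : 0 < k.
    have : 0 < k * (y - x) by rewrite mulrBr; move: gxy; rewrite gx // gy //; lra.
    by rewrite pmulr_lgt0 // subr_gt0.
  have /(piecewise_comp_affine c k0) := pf _ _ (ltW gxy).
  rewrite gx // gy // !addrK ![k * _]mulrC !mulfK ?gt_eqF //.
  by apply: piecewise_eq => t ht /=; rewrite (h t).
apply: (PwCat xy yz); [apply: IH1|apply: IH2] => // s t h1 h2 h3; apply: gi => //; lra.
Qed.

(** * Comparison of functions just after the first difference *)

Definition germ_lt (f g : rat -> rat) x y := exists c d, [/\ x <= c, c < d, d <= y,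
  forall t, x <= t < c -> f t = g t & forall t, c < t < d -> f t < g t].

Lemma affine_compare k k' c c' x y : x < y ->
  [\/ forall t, x <= t <= y -> k * t + c = k' * t + c',
      germ_lt (fun t => k * t + c) (fun t => k' * t + c') x y
    | germ_lt (fun t => k' * t + c') (fun t => k * t + c) x y].
Proof.
have H k1 k2 c1 c2 : x < y -> k1 * x + c1 < k2 * x + c2 ->
    germ_lt (fun t => k1 * t + c1) (fun t => k2 * t + c2) x y.
  move=> xy hx; have [kk|kk] := leP k1 k2.
    exists x, y; split=> // t ht; first by lra.
    have : 0 <= (k2 - k1) * (t - x) by apply: mulr_ge0; lra.
    by nra.
  (* The two lines meet at [z]; the comparison made at [x] persists up to there. *)
  pose z := (c2 - c1) / (k1 - k2).
  have kk0 : 0 < k1 - k2 by lra.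
  have xz : x < z by rewrite /z ltr_pdivlMr //; nra.
  exists x, (Num.min y z); split=> //; first by rewrite lt_min xy.
  - by rewrite ge_min lexx.
  - by move=> t ht; lra.
  - move=> t /andP[ht]; rewrite lt_min => /andP[ty]; rewrite /z ltr_pdivlMr //.
    by nra.
move=> xy; have [hx|hx|hx] := ltgtP (k * x + c) (k' * x + c').
- by constructor 2; apply: H.
- by constructor 3; apply: H.
have [kk|kk|kk] := ltgtP k k'.
- constructor 2; exists x, y; split=> // t ht; first by lra.
  have : 0 < (k' - k) * (t - x) by apply: mulr_gt0; lra.
  by nra.
- constructor 3; exists x, y; split=> // t ht; first by lra.
  have : 0 < (k - k') * (t - x) by apply: mulr_gt0; lra.
  by nra.
- by constructor 1 => t _; rewrite kk in hx *; lra.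
Qed.

(** The first piece on which the functions differ decides. *)
Lemma piecewise_compare f g x y : x < y ->
  piecewise (fun s t => affine_on f s t /\ affine_on g s t) x y ->
  [\/ forall t, x <= t <= y -> f t = g t, germ_lt f g x y | germ_lt g f x y].
Proof.
move=> xy pw; elim: pw xy => {x y} [x y [[k [c hf]] [k' [c' hg]]] xy|].
  have [h|[s [t [xs st ty e l]]]|[s [t [xs st ty e l]]]] := affine_compare k k' c c' xy.
  - by constructor 1 => t ht; rewrite hf ?hg ?h.
  - constructor 2; exists s, t; split=> // u hu;
      by rewrite hf ?hg; first [exact: e|exact: l|lra].
  - constructor 3; exists s, t; split=> // u hu;
      by rewrite hf ?hg; first [exact: e|exact: l|lra].
move=> x y z xy yz _ IH1 _ IH2 xz.
have [E|nxy] := eqVneq x y; first by rewrite E; apply: IH2; rewrite -E.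
have [E|nyz] := eqVneq y z; first by rewrite -E; apply: IH1; rewrite E.
have {}xy : x < y by rewrite lt_neqAle nxy.
have {}yz : y < z by rewrite lt_neqAle nyz.
case: (IH1 xy) => [e1|[s [t [xs st ty e l]]]|[s [t [xs st ty e l]]]].
- case: (IH2 yz) => [e2|[s [t [xs st ty e l]]]|[s [t [xs st ty e l]]]].
  + constructor 1 => t ht; have [ty|yt] := leP t y; [apply: e1|apply: e2]; lra.
  + constructor 2; exists s, t; split=> //; first by lra.
    by move=> u hu; have [uy|yu] := leP u y; [apply: e1|apply: e]; lra.
  + constructor 3; exists s, t; split=> //; first by lra.
    by move=> u hu; have [uy|yu] := leP u y; [apply/esym/e1|apply: e]; lra.
- by constructor 2; exists s, t; split=> //; lra.
- by constructor 3; exists s, t; split=> //; lra.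
Qed.

Definition precedes (f g : rat -> rat) : Prop := exists c d, [/\ 0 <= c, c < d,
  forall t, 0 <= t < c -> f t = g t & forall t, c < t < d -> f t < g t].

Lemma precedes_irr f : ~ precedes f f.
Proof.
move=> [c [d [_ cd _ /(_ ((c + d) / 2))]]]; rewrite ltxx => h.
by suff: false by []; apply: h; lra.
Qed.

Lemma precedes_trans f g h : precedes f g -> precedes g h -> precedes f h.
Proof.
move=> [c [d [c0 cd e l]]] [c' [d' [c0' cd' e' l']]].
have [cc|cc|cc] := ltgtP c c'.
- exists c, (Num.min d c'); split=> // [|t ht|t].
  + by rewrite lt_min cd.
  + by rewrite e // e' //; lra.
  + by rewrite lt_min => /and3P[h1 h2 h3]; rewrite -e' ?l //; lra.
- exists c', (Num.min d' c); split=> // [|t ht|t].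
  + by rewrite lt_min cd'.
  + by rewrite e ?e' //; lra.
  + by rewrite lt_min => /and3P[h1 h2 h3]; rewrite e ?l' //; lra.
- subst c'; exists c, (Num.min d d'); split=> // [|t ht|t].
  + by rewrite lt_min cd.
  + by rewrite e ?e'.
  + by rewrite lt_min => /and3P[h1 h2 h3]; apply: lt_trans (l _ _) (l' _ _); lra.
Qed.

Lemma precedes_total f g L : 0 < L ->
  piecewise (affine_on f) 0 L -> piecewise (affine_on g) 0 L ->
  [\/ forall t, 0 <= t <= L -> f t = g t, precedes f g | precedes g f].
Proof.
move=> L0 pf pg; have pfg := piecewise_and (@affine_hereditary f)
  (@affine_hereditary g) (ltW L0) pf pg.
have [e|[c [d [? ? _ ? ?]]]|[c [d [? ? _ ? ?]]]] := piecewise_compare L0 pfg.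
- by constructor 1.
- by constructor 2; exists c, d.
- by constructor 3; exists c, d.
Qed.

Lemma precedes_postcomp (h f g : rat -> rat) : (forall s t, s < t -> h s < h t) ->
  precedes f g -> precedes (h \o f) (h \o g).
Proof.
move=> hi [c [d [c0 cd e l]]]; exists c, d; split=> // t ht /=; first by rewrite e.
by apply: hi; apply: l.
Qed.

(** As [h] fixes 0 and is increasing, its inverse moves the first point of difference without
    leaving the half-line to the right of 0. *)
Lemma precedes_precomp (h h' f g : rat -> rat) : cancel h h' -> cancel h' h ->
  (forall s t, s < t -> h s < h t) -> h 0 = 0 ->
  precedes f g -> precedes (f \o h) (g \o h).
Proof.
move=> hK h'K hi h0 [c [d [c0 cd e l]]].
have mono s t : (h s < h t) = (s < t).
  apply/idP/idP => [|/hi//]; apply: contraTT; rewrite -!leNgt le_eqVlt.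
  by case/orP=> [/eqP ->//|/hi/ltW].
have lth' s t : (s < h' t) = (h s < t) by rewrite -mono h'K.
have h'lt s t : (h' s < t) = (s < h t) by rewrite -mono h'K.
exists (h' c), (h' d); split=> [||t|t] /=.
- by rewrite leNgt h'lt h0 -leNgt.
- by rewrite lth' h'K.
- by rewrite lth' leNgt -(mono t 0) h0 -leNgt; apply: e.
- by rewrite lth' h'lt; apply: l.
Qed.

(** * Stretchings and letters *)

(** These act on the whole rational line, so that composition is always defined. No inverse is
    stored: inverses come from inverse paths. *)
Record plmap := PLMap {
  plfun :> rat -> rat;
  pl_incr : forall s t, s < t -> plfun s < plfun t;
  pl_piecewise : forall s t, s <= t -> piecewise (affine_on plfun) s t
}.

Lemma plmap_inj (h k : plmap) : plfun h = plfun k -> h = k.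
Proof.
case: h k => [f i p] [g i' p'] /= E; subst g.
by rewrite (Prop_irrelevance i i') (Prop_irrelevance p p').
Qed.

Lemma pl_mono (h : plmap) s t : (h s < h t) = (s < t).
Proof.
apply/idP/idP => [|/pl_incr //]; apply: contraTT; rewrite -!leNgt le_eqVlt.
by case/orP=> [/eqP ->//|/pl_incr/ltW].
Qed.

Lemma pl_mono_le (h : plmap) s t : (h s <= h t) = (s <= t).
Proof. by rewrite !leNgt pl_mono. Qed.

Lemma pl_id_subproof s t : s <= t -> piecewise (affine_on id) s t.
Proof. by move=> _; apply: PwBase; exists 1, 0 => u _; ring. Qed.

Definition pl_id := @PLMap id (fun _ _ => id) pl_id_subproof.

Section Compose.
Variables h k : plmap.

Lemma pl_comp_incr s t : s < t -> (h \o k) s < (h \o k) t.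
Proof. by move=> st; apply: pl_incr; apply: pl_incr. Qed.

Lemma pl_comp_piecewise s t : s <= t -> piecewise (affine_on (h \o k)) s t.
Proof.
move=> st; apply: piecewise_comp => //.
- exact: pl_piecewise.
- by move=> u v _ uv _; apply: pl_incr.
- exact: pl_piecewise.
Qed.

Definition pl_comp := PLMap pl_comp_incr pl_comp_piecewise.

End Compose.

Section Stretch.
Variables (a n m : rat).
Implicit Types s t : rat.

(* The inverse image, on coordinates, of replacing a piece of length [m] at
   position [a] by a piece of length [n]. *)
Definition stretch (t : rat) : rat :=
  if t <= a then t else if t <= a + n then a + (t - a) * (m / n) else t + m - n.

Lemma stretch_low t : t <= a -> stretch t = t.
Proof. by rewrite /stretch => ->. Qed.

Lemma stretch_mid t : a <= t <= a + n -> stretch t = a + (t - a) * (m / n).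
Proof.
rewrite /stretch => /andP[at_ ->]; case: leP => // ta.
have -> : t = a by lra.
by ring.
Qed.

Lemma stretch_high t : 0 < n -> a + n <= t -> stretch t = t + m - n.
Proof.
move=> n0 h; have nq : n * (m / n) = m by rewrite mulrC divfK // gt_eqF.
 have [E|ne] := eqVneq t (a + n).
  rewrite stretch_mid E; last by lra.
  by rewrite [_ - a]addrAC subrr add0r nq; ring.
have lt : a + n < t by rewrite lt_neqAle eq_sym ne.
by rewrite /stretch !leNgt lt (lt_trans _ lt) //=; lra.
Qed.

Lemma stretch_incr s t : 0 < n -> 0 < m -> s < t -> stretch s < stretch t.
Proof.
move=> n0 m0 st; have q0 : 0 < m / n by exact: divr_gt0.
have nq : n * (m / n) = m by rewrite mulrC divfK // gt_eqF.
 have P u v : u < v -> u * (m / n) < v * (m / n) by rewrite ltr_pM2r.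
have [sa|sa] := leP s a; have [ta|ta] := leP t a.
- by rewrite !stretch_low.
- rewrite stretch_low //; have [tn|tn] := leP t (a + n).
    rewrite stretch_mid ?(ltW ta) //; have : 0 < (t - a) * (m / n) by rewrite mulr_gt0 ?subr_gt0.
    by lra.
  by rewrite stretch_high; lra.
- lra.
- have [tn|tn] := leP t (a + n).
    rewrite !stretch_mid; try lra.
    have := P (s - a) (t - a); rewrite ltrD2r => /(_ st); lra.
  rewrite (@stretch_high t) //; last by lra.
  have [sn|sn] := leP s (a + n); last by rewrite stretch_high; lra.
  rewrite stretch_mid; last by lra.
  have : (s - a) * (m / n) <= n * (m / n) by rewrite ler_pM2r //; lra.
  by rewrite nq; lra.
Qed.

Lemma stretch_piecewise s t : 0 < n -> s <= t -> piecewise (affine_on stretch) s t.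
Proof.
move=> n0 st; apply: (@piecewise_sub _ (Num.min s a) (Num.max t (a + n))).
- exact: affine_hereditary.
- apply: (PwCat (y := a)); first by rewrite ge_min lexx orbT.
  + by rewrite le_max; apply/orP; right; lra.
  + by apply: PwBase; exists 1, 0 => u /andP[_ ua]; rewrite stretch_low //; lra.
  apply: (PwCat (y := a + n)); first by lra.
  + by rewrite le_max lexx orbT.
  + apply: PwBase; exists (m / n), (a - a * (m / n)) => u hu; rewrite stretch_mid //.
    by ring.
  + by apply: PwBase; exists 1, (m - n) => u /andP[hu _]; rewrite stretch_high //; lra.
- by rewrite ge_min lexx.
- by [].
- by rewrite le_max lexx.
Qed.

Definition pl_stretch (n0 : 0 < n) (m0 : 0 < m) :=
  PLMap (fun s t => @stretch_incr s t n0 m0) (fun s t => @stretch_piecewise s t n0).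

End Stretch.

Lemma stretchK (a n m : rat) : 0 < n -> 0 < m -> cancel (stretch a n m) (stretch a m n).
Proof.
move=> n0 m0 t.
have q0 : 0 < m / n by exact: divr_gt0.
have nq : n * (m / n) = m by rewrite mulrC divfK // gt_eqF.
have [ta|ta] := leP t a; first by rewrite !stretch_low.
have [tn|tn] := leP t (a + n).
  rewrite (stretch_mid m (t := t)) ?(ltW ta) // stretch_mid.
    by field; rewrite !gt_eqF.
  have h1 : 0 <= (t - a) * (m / n) by rewrite mulr_ge0 // ?(ltW q0) //; lra.
  have h2 : (t - a) * (m / n) <= n * (m / n) by rewrite ler_pM2r //; lra.
  by lra.
by rewrite (stretch_high m n0 (ltW tn)) (stretch_high n m0); lra.
Qed.

(** The identity behind the squares: the second piece begins at [a + n + q] once the first piece is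
    replaced, and at [a + m + q] before. *)
Lemma stretch_stretch (a n m q n' m' t : rat) :
  0 < n -> 0 < m -> 0 < n' -> 0 < m' -> 0 <= q ->
  stretch a n m (stretch (a + n + q) n' m' t) =
  stretch (a + m + q) n' m' (stretch a n m t).
Proof.
move=> n0 m0 n'0 m'0 q0; have q'0 : 0 < m' / n' by exact: divr_gt0.
have nq : n * (m / n) = m by rewrite mulrC divfK // gt_eqF.
have [ta|ta] := leP t a; first by rewrite !stretch_low //; lra.
have [tn|tn] := leP t (a + n).
  rewrite (@stretch_low _ n' m' t); last by lra.
  rewrite stretch_mid ?(ltW ta) // stretch_low //.
  have h2 : (t - a) * (m / n) <= n * (m / n).
    by rewrite ler_pM2r ?divr_gt0 //; lra.
  by lra.
rewrite (@stretch_high a n m t n0 (ltW tn)).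
have [tq|tq] := leP t (a + n + q).
  rewrite (@stretch_low (a + n + q) n' m' t) // (@stretch_high a n m t n0 (ltW tn)).
  by rewrite stretch_low //; lra.
have [tn'|tn'] := leP t (a + n + q + n').
  rewrite (@stretch_mid (a + n + q) n' m' t) ?(ltW tq) //.
  have h1 : 0 <= (t - (a + n + q)) * (m' / n') by rewrite mulr_ge0 // ?(ltW q'0) //; lra.
  rewrite stretch_high //; last by lra.
  rewrite stretch_mid; last by lra.
  have -> : t + m - n - (a + m + q) = t - (a + n + q) by ring.
  by ring.
rewrite (@stretch_high (a + n + q) n' m' t n'0 (ltW tn')).
rewrite (@stretch_high a n m) //; last by lra.
by rewrite stretch_high //; lra.
Qed.

Definition clamp (t : rat) : rat := if t <= 0 then 0 else if t <= 1 then t else 1.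

Lemma clamp_id (t : rat) : 0 <= t <= 1 -> clamp t = t.
Proof. by rewrite /clamp => /andP[h1 ->]; case: leP => // h2; lra. Qed.

Lemma clamp_itv (t : rat) : 0 <= clamp t <= 1.
Proof.
by rewrite /clamp; have [?|?] := leP t 0; have [?|?] := leP t 1;
  rewrite ?lexx ?ler01 //=; lra.
Qed.

Lemma clampK t : clamp (clamp t) = clamp t.
Proof. by rewrite clamp_id ?clamp_itv. Qed.

(* A letter is a cell together with a piecewise affine chart of the interval
   that it occupies; the chart is extended by constants outside [0, 1], so that
   letters with the same chart are equal. *)
Record letter (C : Type) := Letter {
  lcell : C;
  lmap :> rat -> rat;
  lmap_incr : forall s t, 0 <= s -> s < t -> t <= 1 -> lmap s < lmap t;
  lmap_piecewise : piecewise (affine_on lmap) 0 1;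
  lmap_clamp : forall t, lmap (clamp t) = lmap t
}.

HB.instance Definition _ C := gen_eqMixin (letter C).

Section Letters.
Variables (C : Type) (clt : C -> C -> Prop).
Hypothesis clt_total : strict_total clt.
Local Notation letter := (letter C).

Lemma letter_inj (x y : letter) : lcell x = lcell y -> lmap x = lmap y -> x = y.
Proof.
case: x y => [c f i p l] [d g i' p' l'] /= E E'; subst d g.
by rewrite (Prop_irrelevance i i') (Prop_irrelevance p p') (Prop_irrelevance l l').
Qed.

Section Segment.
Variables (c : C) (a m : rat).
Hypothesis m0 : 0 < m.

Lemma segment_incr s t : 0 <= s -> s < t -> t <= 1 ->
  a + m * clamp s < a + m * clamp t.
Proof. by move=> s0 st t1; rewrite !clamp_id ?ltrD2l ?ltr_pM2l //; lra. Qed.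

Lemma segment_piecewise : piecewise (affine_on (fun t => a + m * clamp t)) 0 1.
Proof. by apply: PwBase; exists m, a => t ht; rewrite clamp_id //; ring. Qed.

Lemma segment_clamp t : a + m * clamp (clamp t) = a + m * clamp t.
Proof. by rewrite clampK. Qed.

Definition segment := @Letter C c _ segment_incr segment_piecewise segment_clamp.

End Segment.

Section Act.
Variables (h : plmap) (x : letter).

Lemma act_incr s t : 0 <= s -> s < t -> t <= 1 -> (h \o x) s < (h \o x) t.
Proof. by move=> *; apply: pl_incr; apply: lmap_incr. Qed.

Lemma act_piecewise : piecewise (affine_on (h \o x)) 0 1.
Proof.
apply: piecewise_comp (lmap_incr x) (lmap_piecewise x) => //.
exact: pl_piecewise.
Qed.

Lemma act_clamp t : (h \o x) (clamp t) = (h \o x) t.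
Proof. by rewrite /= lmap_clamp. Qed.

Definition act := @Letter C (lcell x) _ act_incr act_piecewise act_clamp.

End Act.

Lemma act_id x : act pl_id x = x.
Proof. exact: letter_inj. Qed.

Lemma act_comp h k x : act (pl_comp h k) x = act h (act k x).
Proof. exact: letter_inj. Qed.

Definition lcomm (x y : letter) : bool := (x 1 <= y 0) || (y 1 <= x 0).

Lemma lcommE x y : lcomm x y = (x 1 <= y 0) || (y 1 <= x 0).
Proof. by []. Qed.

Lemma lcomm_sym : symmetric lcomm.
Proof. by move=> x y; rewrite /lcomm orbC. Qed.

Lemma lcomm_act h x y : lcomm (act h x) (act h y) = lcomm x y.
Proof. by rewrite /lcomm /= !pl_mono_le. Qed.

(** Germs of charts come first, so that increasing maps preserve the order; cells decide between
    equal charts. *)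
Definition llt (x y : letter) : Prop :=
  precedes x y \/ lmap x = lmap y /\ clt (lcell x) (lcell y).

Lemma llt_total : strict_total llt.
Proof.
have [irr tr tot] := clt_total; split.
- by move=> x [/precedes_irr|[_ /irr]].
- move=> x y z [xy|[Exy xy]] [yz|[Eyz yz]].
  + by left; apply: precedes_trans yz.
  + by left; rewrite -Eyz.
  + by left; rewrite Exy.
  + by right; split; [rewrite Exy|apply: tr yz].
- move=> x y xy; have [E|ne] := pselect (lmap x = lmap y).
    have [|l|l] := tot (lcell x) (lcell y); [|by left; right|by right; right].
    by move=> E'; apply: xy; apply: letter_inj.
  have [e|l|l] := precedes_total ltr01 (lmap_piecewise x) (lmap_piecewise y).
  (* Charts that agree on [0, 1] agree everywhere, being constant outside. *)
  + case: ne; apply: funext => t.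
    by rewrite -[LHS]lmap_clamp -[RHS]lmap_clamp e // clamp_itv.
  + by left; left.
  + by right; left.
Qed.

Lemma llt_act h x y : llt x y -> llt (act h x) (act h y).
Proof.
move=> [l|[E l]]; [left|right].
  by apply: precedes_postcomp => //; apply: pl_incr.
by rewrite /= E.
Qed.

End Letters.

(** * Existence of total orders, and factorisations of lists *)

Lemma exists_strict_total (T : Type) : exists lt : T -> T -> Prop, strict_total lt.
Proof.
have [R wo] := well_ordering_principle {classic T}.
have wc : wo_chain R predT by apply: (withinW (A := predT)).
have tot x y : R x y || R y x by apply: (wo_chainW wc).
have anti x y : R x y -> R y x -> x = y.
  by move=> xy yx; apply: (wo_chain_antisymmetric wc) => //; rewrite xy.
(* Transitivity is read off from a least element of the three points. *)
have tr x y z : R x y -> R y z -> R x z.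
  move=> xy yz; have ne : nonempty [mem [:: x; y; z] : seq {classic T}].
    by exists x; apply: mem_head.
  have [m [[+ /allP/and4P[]]]] := wo _ ne.
  rewrite /= !inE => /or3P[] /eqP-> h1 h2 h3 _ _ //.
    by rewrite (anti x y).
  by rewrite -(anti y z).
exists (fun x y => R x y /\ x <> y); split=> [x [] //|x y z [xy nxy] [yz nyz]|x y nxy].
  split; first exact: tr yz.
  by move=> E; apply: nxy; apply: anti => //; rewrite E.
by have /orP[h|h] := tot x y; [left|right; split=> // E; apply: nxy].
Qed.

Lemma cat_eq_prefix (T : Type) (s t s' t' : seq T) : s ++ t = s' ++ t' ->
  (size s <= size s')%N -> exists r, s' = s ++ r /\ t = r ++ t'.
Proof.
elim: s s' => [|x s IH] [|y s'] //=; [by exists [::]|by exists (y :: s')|].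
by move=> [-> /IH h] /h[r [-> ->]]; exists r.
Qed.

Lemma cat_eq_size (T : Type) (s t s' t' : seq T) : size s = size s' ->
  s ++ t = s' ++ t' -> s = s' /\ t = t'.
Proof.
move=> ss E; have := congr1 (take (size s)) E; have := congr1 (drop (size s)) E.
by rewrite take_size_cat // drop_size_cat // ss take_size_cat // drop_size_cat.
Qed.

(** * Loops in the Squier complex *)

Section SquierRepresentation.
Variables (K : dcomplex2) (clt : dcell K -> dcell K -> Prop).
Hypothesis clt_total : strict_total clt.
Local Notation edge := (sq_edge K).
Local Notation letter := (letter (dcell K)).
Local Notation lcomm := (@lcomm (dcell K)).
Local Notation trivial_word := (trivial_word lcomm).
Local Notation ewalk := (walk (@sqe_ini K) (@sqe_ter K)).

Definition len (s : seq (dedge K)) : rat := (size s)%:R.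

Lemma len_gt0 s : s <> [::] -> 0 < len s.
Proof. by case: s => // e s _; rewrite ltr0n. Qed.

Lemma len_ge0 s : 0 <= len s.
Proof. exact: ler0n. Qed.

Lemma len_cat s t : len (s ++ t) = len s + len t.
Proof. by rewrite /len size_cat natrD. Qed.

(* Only one cell of each pair [f], [dinv f] gives letters. *)
Definition cpos (f : dcell K) : bool := `[< clt f (dinv f) >].
Definition clabel (f : dcell K) : dcell K := if cpos f then f else dinv f.

Lemma cpos_dinv f : cpos (dinv f) = ~~ cpos f.
Proof.
have [irr tr tot] := clt_total.
rewrite /cpos dinvK; apply/asboolP/negP => [h /asboolP h'|h].
  exact: irr (tr _ _ _ h h').
by case: (tot f (dinv f)) => // [E|l]; [apply: (@dinv_neq K f)|case: h; apply/asboolP].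
Qed.

Lemma clabel_dinv f : clabel (dinv f) = clabel f.
Proof. by rewrite /clabel cpos_dinv dinvK; case: (cpos f). Qed.

Lemma clabel_inj f g : clabel f = clabel g -> cpos g = ~~ cpos f -> g = dinv f.
Proof.
by move=> E c; move: E; rewrite /clabel c; case: (cpos f) => /= [->|//]; rewrite dinvK.
Qed.

(** Coordinates on the terminal path are carried back to the initial path, so that composites along
    a path express everything in the coordinates of its start. *)
Definition emap (e : edge) : plmap :=
  pl_stretch (len (sqe_l e)) (len_gt0 (@bot_neq0 K (sqe_cell e)))
    (len_gt0 (@top_neq0 K (sqe_cell e))).

Definition eletter (e : edge) : letter :=
  segment (clabel (sqe_cell e)) (len (sqe_l e)) (len_gt0 (@top_neq0 K (sqe_cell e))).

Lemma emap_inv e : pl_comp (emap e) (emap (sqe_inv e)) = pl_id.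
Proof.
apply: plmap_inj; apply: funext => t /=.
by rewrite top_inv bot_inv stretchK //; apply: len_gt0; [apply: top_neq0|apply: bot_neq0].
Qed.

(** Seen from the start of [e], the inverse edge has the same letter; only the sign given by [cpos]
    differs. *)
Lemma eletter_inv e : act (emap e) (eletter (sqe_inv e)) = eletter e.
Proof.
apply: letter_inj => /=; first exact: clabel_dinv.
apply: funext => t /=; rewrite top_inv.
have b0 := len_gt0 (@bot_neq0 K (sqe_cell e)).
have /andP[c0 c1] := clamp_itv t.
rewrite stretch_mid; last by rewrite lerDl lerD2l mulr_ge0 ?(ltW b0) //= ler_piMr ?(ltW b0).
by field; rewrite gt_eqF.
Qed.

Lemma act_inj h x y : act h x = act h y -> x = y :> letter.
Proof.
move=> E; apply: letter_inj; first exact: (congr1 (@lcell _) E).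
apply: funext => t; have /(congr1 (fun k => k t)) := congr1 (@lmap _) E => /= Et.
by apply: le_anti; rewrite -(pl_mono_le h (x t)) -(pl_mono_le h (y t)) Et lexx.
Qed.

Fixpoint hol (s : seq edge) : plmap :=
  if s is e :: s' then pl_comp (emap e) (hol s') else pl_id.

Definition relabel (h : plmap) (W : seq (letter * bool)) :=
  [seq (act h x.1, x.2) | x <- W].

(** Later letters are transported to the start of the path. The pair of [hol] and [tword] thus
    multiplies as in a semidirect product, see [tword_cat]. *)
Fixpoint tword (s : seq edge) : seq (letter * bool) :=
  if s is e :: s' then (eletter e, cpos (sqe_cell e)) :: relabel (emap e) (tword s')
  else [::].

Lemma size_tword s : size (tword s) = size s.
Proof. by elim: s => //= e s IH; rewrite size_map IH. Qed.

Lemma pl_compA h k l : pl_comp h (pl_comp k l) = pl_comp (pl_comp h k) l.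
Proof. exact: plmap_inj. Qed.

Lemma pl_comp1 h : pl_comp pl_id h = h.
Proof. exact: plmap_inj. Qed.

Lemma pl_comp_id h : pl_comp h pl_id = h.
Proof. exact: plmap_inj. Qed.

Lemma relabel_id W : relabel pl_id W = W.
Proof. by elim: W => //= -[x b] W ->; rewrite act_id. Qed.

Lemma relabel_comp h k W : relabel (pl_comp h k) W = relabel h (relabel k W).
Proof. by rewrite /relabel -map_comp; apply: eq_map => x /=; rewrite act_comp. Qed.

Lemma relabel_cat h W1 W2 : relabel h (W1 ++ W2) = relabel h W1 ++ relabel h W2.
Proof. exact: map_cat. Qed.

Lemma hol_cat s1 s2 : hol (s1 ++ s2) = pl_comp (hol s1) (hol s2).
Proof. by elim: s1 => /= [|e s1 ->]; rewrite ?pl_comp1 ?pl_compA. Qed.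

Lemma tword_cat s1 s2 : tword (s1 ++ s2) = tword s1 ++ relabel (hol s1) (tword s2).
Proof.
by elim: s1 => /= [|e s1 ->]; rewrite ?relabel_id // relabel_cat relabel_comp.
Qed.

Lemma trivial_relabel h W : trivial_word W -> trivial_word (relabel h W).
Proof. by apply: trivial_map => x y; apply: lcomm_act. Qed.

(** * Squares and invariance under homotopy *)

Section Square.
Variable c : sq_face K.
Local Notation e1 := (sqf_edge1 c).
Local Notation e2 := (sqf_edge2 c).
Local Notation e3 := (sqf_edge3 c).
Local Notation e4 := (sqf_edge4 c).

Lemma emap_square : pl_comp (emap e1) (emap e2) = pl_comp (emap e4) (emap e3).
Proof.
apply: plmap_inj; apply: funext => t /=; rewrite !len_cat !addrA.
by apply: stretch_stretch; rewrite ?len_ge0 //; apply: len_gt0;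
  first [apply: top_neq0|apply: bot_neq0].
Qed.

(** A move on the right leaves the interval of the left cell in place. *)
Lemma eletter_square1 : act (emap e4) (eletter e3) = eletter e1.
Proof.
apply: letter_inj => //; apply: funext => t /=; have /andP[c0 c1] := clamp_itv t.
rewrite stretch_low // !len_cat.
rewrite lerD2l (le_trans (y := len (top (sqf_cell1 c)))) ?ler_piMr ?len_ge0 //.
by rewrite lerDl len_ge0.
Qed.

(** The move of the left cell merely translates the interval of the right one. *)
Lemma eletter_square2 : act (emap e1) (eletter e2) = eletter e4.
Proof.
apply: letter_inj => //; apply: funext => t /=; have /andP[c0 c1] := clamp_itv t.
have b0 := len_gt0 (@bot_neq0 K (sqf_cell1 c)).
rewrite stretch_high // ?len_cat; first by ring.
have q0 := len_ge0 (sqf_m c).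
have h : 0 <= len (top (sqf_cell2 c)) * clamp t by rewrite mulr_ge0 ?len_ge0.
by lra.
Qed.

Lemma lcomm_square : lcomm (eletter e1) (eletter e4).
Proof.
apply/orP; left => /=; rewrite !clamp_id ?lexx ?ler01 // mulr1 mulr0 !len_cat.
by rewrite addr0 addrA lerDl len_ge0.
Qed.

End Square.

Lemma hol_backtrack e : hol [:: e; sqe_inv e] = pl_id.
Proof. by rewrite /= pl_comp_id emap_inv. Qed.

Lemma hol_square c : hol (sq_boundary c) = pl_id.
Proof.
rewrite /= pl_comp_id pl_compA emap_square -pl_compA (pl_compA (emap (sqf_edge3 c))).
by rewrite emap_inv pl_comp1 emap_inv.
Qed.

Lemma trivial_backtrack_tword e : trivial_word (tword [:: e; sqe_inv e]).
Proof. by rewrite /= eletter_inv cpos_dinv; apply: trivial_backtrack. Qed.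

(** In the coordinates of the start the four letters are those of [sqf_edge1] and [sqf_edge4], each
    with both signs, so the word is a commutator. *)
Lemma trivial_square c : trivial_word (tword (sq_boundary c)).
Proof.
have sq x : act (emap (sqf_edge1 c)) (act (emap (sqf_edge2 c)) x) =
    act (emap (sqf_edge4 c)) (act (emap (sqf_edge3 c)) x).
  by rewrite -!act_comp emap_square.
rewrite /= !sq -(act_comp (emap (sqf_edge3 c))) emap_inv act_id eletter_square2.
rewrite !eletter_inv eletter_square1 !cpos_dinv.
by apply: trivial_commutator; [apply: lcomm_sym|apply: lcomm_square].
Qed.

Lemma null_word_trivial (t : seq (Defs.edge (squier K))) :
  null_word t -> hol t = pl_id /\ trivial_word (tword t).
Proof.
case=> [e|c]; split.
- exact: hol_backtrack.
- exact: trivial_backtrack_tword.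
- exact: hol_square.
- exact: trivial_square.
Qed.

Variable w : npath K.
Local Notation loop := (@loop (squier K) w).

Lemma homotopic_hol (a b : loop) : homotopic a b -> hol a = hol b.
Proof.
elim=> {a b} [a b [s1 [t [s2 [nt -> ->]]]]|a|a b _ ->|a b d _ -> _ ->] //.
by have [ht _] := null_word_trivial nt; rewrite !hol_cat ht pl_comp1.
Qed.

Lemma homotopic_tword (a b : loop) phi : homotopic a b -> tracelike lcomm phi ->
  ev (tword a) phi = ev (tword b) phi.
Proof.
move=> ab tphi; elim: ab => {a b} [a b [s1 [t [s2 [nt -> ->]]]]|a|a b _ ->|a b d _ -> _ ->] //.
have [ht tt] := null_word_trivial nt.
rewrite !tword_cat ht relabel_id relabel_cat.
by rewrite (@ev_insert _ lcomm) //; apply: trivial_relabel.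
Qed.

(** * Shortening loops whose word is not reduced *)

Lemma canc_relabel h x s W :
  canc lcomm (act h x) s (relabel h W) = canc lcomm x s W.
Proof.
elim: W => //= -[y t] W ->; rewrite lcomm_act.
by congr (_ && _ || _); apply/eqP/eqP => [/act_inj|->].
Qed.

Lemma reduced_relabel h W : reduced lcomm (relabel h W) = reduced lcomm W.
Proof. by elim: W => //= -[x s] W ->; rewrite canc_relabel. Qed.

(** [h] is arbitrary so that the induction can absorb the map of each edge passed. *)
Lemma canc_split h x b s : canc lcomm x b (relabel h (tword s)) ->
  exists s2 e' s3, [/\ s = s2 ++ e' :: s3, x = act (pl_comp h (hol s2)) (eletter e'),
    cpos (sqe_cell e') = ~~ b
    & all (fun y => lcomm x (act h y.1)) (tword s2)].
Proof.
elim: s h => //= d s IH h; rewrite -relabel_comp => /orP[/andP[/eqP E /eqP Eb]|].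
  by exists [::], d, s; split=> //; rewrite /= pl_comp_id.
move=> /andP[xd /IH[s2 [e' [s3 [-> E Eb al]]]]].
exists (d :: s2), e', s3; split=> //=; first by rewrite pl_compA.
rewrite xd /= all_map; apply: sub_all al => y /=; by rewrite act_comp.
Qed.

Lemma nonreduced_split s : ~~ reduced lcomm (tword s) ->
  exists s1 e s2 e' s3, [/\ s = s1 ++ e :: s2 ++ e' :: s3,
    eletter e = act (pl_comp (emap e) (hol s2)) (eletter e'),
    cpos (sqe_cell e') = ~~ cpos (sqe_cell e)
    & all (fun y => lcomm (eletter e) (act (emap e) y.1)) (tword s2)].
Proof.
elim: s => //= e s IH; rewrite reduced_relabel negb_and negbK => /orP[|/IH].
  by move=> /canc_split[s2 [e' [s3 [-> E Eb al]]]]; exists [::], e, s2, e', s3.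
by move=> [s1 [d [s2 [e' [s3 [-> E Eb al]]]]]]; exists (e :: s1), d, s2, e', s3.
Qed.


Lemma square_walks c : exists x y,
  ewalk x [:: sqf_edge1 c; sqf_edge2 c] y /\ ewalk x [:: sqf_edge4 c; sqf_edge3 c] y.
Proof.
exists (sqe_ini (sqf_edge1 c)), (sqe_ter (sqf_edge2 c)) => /=.
by do !split; apply: npath_inj; rewrite /= -?catA.
Qed.

(** Insert the boundary word before [sqf_edge4] and [sqf_edge3]; these two then cancel against its
    second half. *)
Lemma square_homotopic c s1 s2 (a b : loop) :
  loop_edges a = s1 ++ [:: sqf_edge4 c; sqf_edge3 c] ++ s2 ->
  loop_edges b = s1 ++ [:: sqf_edge1 c; sqf_edge2 c] ++ s2 -> homotopic a b.
Proof.
move=> Ea Eb; have := loop_walk a; rewrite Ea => /walk_cat[z [w1 w2]].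
have wm : ewalk w (s1 ++ sq_boundary c ++ [:: sqf_edge4 c; sqf_edge3 c] ++ s2) w.
  apply/walk_cat; exists z; split=> //; apply/walk_cat; exists z; split=> //.
  have [x wb] := sq_boundary_loop c; move: w2 wb => [<- _] /[dup] -[E _].
  by rewrite -E (@npath_inj _ (sqe_ini (sqf_edge1 c)) (sqe_ini (sqf_edge4 c))) //= -!catA.
apply: (@rst_trans _ _ _ (@Loop (squier K) w _ wm)).
  apply: rst_sym; apply: rst_step; exists s1, (sq_boundary c),
    ([:: sqf_edge4 c; sqf_edge3 c] ++ s2).
  by split=> //; apply: (@null_boundary (squier K)).
apply: (@homotopic_cancel (squier K) w [:: sqe_inv (sqf_edge3 c); sqe_inv (sqf_edge4 c)]
  (s1 ++ [:: sqf_edge1 c; sqf_edge2 c]) s2); last by rewrite -catA.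
by rewrite /word_inv /= /rev /= !sqe_invK -catA.
Qed.

Lemma square_loop c s1 s2 (a : loop) :
  loop_edges a = s1 ++ [:: sqf_edge4 c; sqf_edge3 c] ++ s2 ->
  exists b : loop, loop_edges b = s1 ++ [:: sqf_edge1 c; sqf_edge2 c] ++ s2 /\ homotopic a b.
Proof.
move=> Ea; have := loop_walk a; rewrite Ea; have [x [y [w12 w43]]] := square_walks c.
move=> /(walk_swap _ w43 w12) => wb; exists (@Loop (squier K) w _ (wb ltac:(done))).
by split=> //; apply: square_homotopic Ea _.
Qed.

Lemma square_loop' c s1 s2 (a : loop) :
  loop_edges a = s1 ++ [:: sqf_edge1 c; sqf_edge2 c] ++ s2 ->
  exists b : loop, loop_edges b = s1 ++ [:: sqf_edge4 c; sqf_edge3 c] ++ s2 /\ homotopic a b.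
Proof.
move=> Ea; have := loop_walk a; rewrite Ea; have [x [y [w12 w43]]] := square_walks c.
move=> /(walk_swap _ w12 w43) => wb; exists (@Loop (squier K) w _ (wb ltac:(done))).
by split=> //; apply: rst_sym; apply: square_homotopic _ Ea.
Qed.

(** On the path between the two edges, the bottom of [e] and the top of [d] are disjoint subpaths.
    Hence [e] and [d] are consecutive sides of a square, and the other two sides replace them. *)
Lemma commute_step (e d : edge) : sqe_ter e = sqe_ini d ->
  lcomm (eletter e) (act (emap e) (eletter d)) ->
  exists d' e', [/\ forall s1 s2 (a : loop), loop_edges a = s1 ++ [:: e; d] ++ s2 ->
      exists b : loop, loop_edges b = s1 ++ [:: d'; e'] ++ s2 /\ homotopic a b,
    pl_comp (emap e) (emap d) = pl_comp (emap d') (emap e'),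
    eletter e = act (emap d') (eletter e')
    & sqe_cell e' = sqe_cell e].
Proof.
move=> /(congr1 (@npath_edges K)) /= E; rewrite -{1}eletter_inv lcomm_act.
rewrite lcommE /= top_inv !clamp_id ?lexx ?ler01 //.
rewrite !mulr1 !mulr0 !addr0 -!len_cat !ler_nat => /orP[le|le].
  (* [e] lies to the left of [d], with [r] between them. *)
  move: E; rewrite catA => /cat_eq_prefix/(_ le)[r [Ed Ee]].
  have path : one_path (sqe_l e ++ top (sqe_cell e) ++ r ++ top (sqe_cell d) ++ sqe_r d).
    by have := sqe_path e; rewrite Ee.
  pose c := SqFace path.
  have Ec1 : sqf_edge1 c = e by apply: sq_edge_inj.
  have Ec2 : sqf_edge2 c = d by apply: sq_edge_inj; rewrite //= Ed catA.
  exists (sqf_edge4 c), (sqf_edge3 c); split=> //.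
  - by move=> s1 s2 a; rewrite -{1}Ec1 -{1}Ec2; apply: square_loop'.
  - by rewrite -{1}Ec1 -{1}Ec2 emap_square.
  - by rewrite eletter_square1 Ec1.
(* [e] lies to the right of [d], with [r] between them. *)
move: E; rewrite [RHS]catA => /esym/cat_eq_prefix/(_ le)[r [Ee Ed]].
have path : one_path (sqe_l d ++ top (sqe_cell d) ++ r ++ top (sqe_cell e) ++ sqe_r e).
  by have := sqe_path e; rewrite Ee -!catA.
pose c := SqFace path.
have Ec4 : sqf_edge4 c = e by apply: sq_edge_inj; rewrite //= Ee catA.
have Ec3 : sqf_edge3 c = d by apply: sq_edge_inj; rewrite //= Ed.
exists (sqf_edge1 c), (sqf_edge2 c); split=> //.
- by move=> s1 s2 a; rewrite -{1}Ec4 -{1}Ec3; apply: square_loop.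
- by rewrite -{1}Ec4 -{1}Ec3 emap_square.
- by rewrite eletter_square2 Ec4.
Qed.

Lemma ewalk_consecutive x y s1 s2 (e d : edge) :
  ewalk x (s1 ++ e :: d :: s2) y -> sqe_ter e = sqe_ini d.
Proof. by move=> /walk_cat[z [_ /= [_ [-> _]]]]. Qed.

(* Two occurrences of a letter with opposite signs whose intermediate letters
   all commute with it come from an edge that can be moved through the
   intermediate ones until it meets its inverse. *)
Lemma cancel_shorten s2 s1 e e' s3 (a : loop) :
  loop_edges a = s1 ++ e :: s2 ++ e' :: s3 ->
  eletter e = act (pl_comp (emap e) (hol s2)) (eletter e') ->
  cpos (sqe_cell e') = ~~ cpos (sqe_cell e) ->
  all (fun y => lcomm (eletter e) (act (emap e) y.1)) (tword s2) ->
  exists b : loop, homotopic a b /\ (size (loop_edges b) < size (loop_edges a))%N.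
Proof.
elim: s2 s1 e a => [|d s2 IH] s1 e a Ea El Ep /=.
  move=> _; move: El; rewrite /= pl_comp_id -{1}eletter_inv => /act_inj El.
  have wa := loop_walk a; rewrite Ea /= in wa.
  (* Equal labels with opposite signs give inverse cells; equal charts give the same left end, and
     the path between the edges then fixes the rest. *)
  have Ec : sqe_cell e' = dinv (sqe_cell e).
    by apply: clabel_inj Ep; rewrite -clabel_dinv; have := congr1 (@lcell _) El.
  have El0 : size (sqe_l e) = size (sqe_l e').
    have /(congr1 (fun f => f 0)) := congr1 (@lmap _) El.
    rewrite /= !clamp_id ?lexx ?ler01 // !mulr0 !addr0 => h.
    by apply/eqP; rewrite -(eqr_nat rat); apply/eqP.
  have /(congr1 (@npath_edges K)) /= E := ewalk_consecutive wa.
  have Ee' : e' = sqe_inv e.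
    move: E; rewrite Ec top_inv => E.
    have [E1 /(cat_eq_size erefl)[_ E2]] := cat_eq_size El0 E.
    exact: sq_edge_inj.
  have wb : ewalk w (s1 ++ s3) w.
    move: wa; rewrite Ee' => /walk_cat[z [w1 /= [Ez [_ w2]]]].
    apply/walk_cat; exists z; split=> //; move: w2.
    by rewrite -sqe_ini_inv sqe_invK Ez.
  exists (@Loop (squier K) w _ wb); split; last by rewrite Ea !size_cat /=; lia.
  apply: rst_step; exists s1, [:: e; sqe_inv e], s3; split=> //; last by rewrite Ea Ee'.
  exact: (@null_backtrack (squier K)).
move=> /andP[cd al].
have := loop_walk a; rewrite Ea => /ewalk_consecutive ed.
(* Exchange [e] with its neighbour [d]; only [s2] then separates it from [e']. *)
have [d' [e1 [mv EA EB EC]]] := commute_step ed cd.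
have [b [Eb ab]] := mv _ _ _ Ea.
have [||||b' [bb' sb]] := IH (rcons s1 d') e1 b.
- by rewrite Eb cat_rcons.
- apply: (@act_inj (emap d')); rewrite -EB El /= !act_comp.
  by rewrite -[LHS](act_comp (emap e)) EA act_comp.
- by rewrite EC.
- move: al; rewrite all_map; apply: sub_all => y /=.
  by rewrite -act_comp EA act_comp EB lcomm_act.
exists b'; split; first exact: rst_trans bb'.
by rewrite (leq_trans sb) // Eb !size_cat /= !size_cat.
Qed.

Lemma homotopic_reduced (a : loop) :
  exists b : loop, homotopic a b /\ reduced lcomm (tword (loop_edges b)).
Proof.
have [n] := ubnP (size (loop_edges a)); elim: n a => // n IH a sa.
have [ra|] := boolP (reduced lcomm (tword (loop_edges a))).
  by exists a; split=> //; apply: rst_refl.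
move=> /nonreduced_split[s1 [e [s2 [e' [s3 [Ea El Ep al]]]]]].
have [b [ab sb]] := cancel_shorten Ea El Ep al.
have [|c [bc rc]] := IH b; first exact: leq_trans sb _.
by exists c; split=> //; apply: rst_trans bc.
Qed.

(** * Positive loops *)

Lemma emap_low e t : t <= 0 -> emap e t = t.
Proof. by move=> t0; apply: stretch_low; apply: le_trans t0 (len_ge0 _). Qed.

Lemma hol_low s t : t <= 0 -> hol s t = t.
Proof. by move=> t0; elim: s => //= e s ->; apply: emap_low. Qed.

(** For a loop this gives the identity beyond the interval of [w], so the map is determined by its
    values on that interval. *)
Lemma hol_high u s v t : ewalk u s v -> len v <= t -> hol s t = t + len u - len v.
Proof.
elim: s u => [|e s IH] u /=; first by move=> -> _; rewrite addrK.
move=> [<- /IH h] vt; rewrite h //= !len_cat.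
rewrite stretch_high; first by ring.
  by apply: len_gt0; apply: bot_neq0.
by have := len_ge0 (sqe_r e); lra.
Qed.

(** The lexicographic positive cone of the semidirect product: the homeomorphism decides first, the
    word only if the homeomorphism is trivial. *)
Definition positive_loop (s : seq edge) : Prop :=
  precedes id (hol s) \/ hol s = pl_id /\ positive lcomm (llt clt) (tword s).

Lemma positive_loop_homotopic (a b : loop) :
  homotopic a b -> positive_loop a -> positive_loop b.
Proof.
move=> ab; rewrite /positive_loop (homotopic_hol ab) => -[h|[h p]]; [by left|right].
by split=> //; apply: positive_equiv p => phi; apply: homotopic_tword.
Qed.

Lemma hol_inv (a : loop) : pl_comp (hol (loop_inv a)) (hol a) = pl_id.
Proof. by rewrite -hol_cat; have := homotopic_hol (loop_mulVl a). Qed.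

Lemma hol_invr (a : loop) : pl_comp (hol a) (hol (loop_inv a)) = pl_id.
Proof. by rewrite -hol_cat; have := homotopic_hol (loop_mulV a). Qed.

Lemma not_positive_one : ~ positive_loop [::].
Proof. by move=> [/precedes_irr //|[_ /positive_trivial]]; apply. Qed.

Lemma positive_loop_mul (a b : loop) :
  positive_loop a -> positive_loop b -> positive_loop (loop_mul a b).
Proof.
have post h k : precedes id (plfun k) -> precedes (plfun h) (pl_comp h k).
  by move=> p; apply: (precedes_postcomp (@pl_incr h) p).
rewrite /positive_loop /= hol_cat tword_cat => -[pa|[ha pa]] [pb|[hb pb]].
- by left; apply: precedes_trans (pa) _; apply: post.
- by left; rewrite hb pl_comp_id.
- by left; rewrite ha pl_comp1.
- right; rewrite ha hb pl_comp1 relabel_id; split=> //.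
  by apply: positive_cat => //; apply: llt_total.
Qed.

Lemma positive_loop_conj (c a : loop) :
  positive_loop a -> positive_loop (loop_mul (loop_mul c a) (loop_inv c)).
Proof.
rewrite /positive_loop /= !tword_cat !hol_cat.
have cK : cancel (hol c) (hol (loop_inv c)).
  by move=> t; have /(congr1 (fun h => plfun h t)) := hol_inv c.
have cK' : cancel (hol (loop_inv c)) (hol c).
  by move=> t; have /(congr1 (fun h => plfun h t)) := hol_invr c.
move=> [pa|[ha pa]]; [left|right].
  (* Compose the comparison of [id] with [hol a] by [hol c] on the left and by its inverse on the
     right. *)
  have := precedes_precomp cK' cK (@pl_incr _) (hol_low _ (lexx 0))
    (precedes_postcomp (@pl_incr (hol c)) pa).
  by congr precedes; apply: funext => t /=; rewrite cK'.
rewrite ha pl_comp_id; split; first exact: hol_invr.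
(* Since [hol a] is trivial, the outer words together are the word of [c] followed by its inverse,
   which is trivial; the middle is the word of [a] relabelled by [hol c]. *)
rewrite -catA; apply: positive_sandwich.
  rewrite -tword_cat => phi tphi.
  exact: (homotopic_tword (loop_mulV c) tphi).
apply: (@positive_map _ lcomm (llt clt) (llt_total clt_total)
  (act (hol c)) (act (hol (loop_inv c)))) => //.
- by move=> x; rewrite -act_comp hol_inv act_id.
- by move=> x; rewrite -act_comp hol_invr act_id.
- by move=> x y; apply: llt_act.
- exact: lcomm_act.
Qed.

Lemma positive_loop_total (a : loop) : ~ homotopic a (@loop_one (squier K) w) ->
  positive_loop a \/ positive_loop (loop_inv a).
Proof.
move=> na.
have L0 : 0 < len w by apply: len_gt0; apply: npath_neq0.
have [h|h|h] := precedes_total L0 (pl_piecewise pl_id (ltW L0))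
  (pl_piecewise (hol a) (ltW L0)).
- have ha : hol a = pl_id.
    apply: plmap_inj; apply: funext => t; have [t0|t0] := leP t 0; first exact: hol_low.
    have [tL|tL] := leP t (len w); first by rewrite -h // (ltW t0).
    by rewrite (hol_high (loop_walk a)) ?(ltW tL) // addrK.
  have hi : hol (loop_inv a) = pl_id by have := hol_inv a; rewrite ha pl_comp_id.
  (* A reduced representative is not the empty loop, so its expansion has a nonzero coefficient of
     positive degree, which [a] shares by homotopy invariance. *)
  have [b [ab rb]] := homotopic_reduced a.
  have [m [_ _ em nm _]] := reduced_witness (@lcomm_sym _) rb.
  have m0 : m <> [::].
    apply: nm => E; apply: na; rewrite (@loop_inj _ _ (@loop_one (squier K) w) b) //=.
    by apply/esym/size0nil; rewrite -size_tword E.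
  have em' : ev (tword a) (trace_ind lcomm m) <> 0.
    by rewrite (homotopic_tword ab) //; apply: tracelike_ind.
  have [|p|p] := @positive_total _ _ _ (llt_total clt_total) _
    (tword (loop_inv a)) _ m0 em'.
  + move=> phi tphi; have /= := homotopic_tword (loop_mulV a) tphi.
    by rewrite tword_cat ha relabel_id.
  + by left; right.
  + by right; right.
- by left; left.
- right; left; have := precedes_postcomp (@pl_incr (hol (loop_inv a))) h.
  by have -> : hol (loop_inv a) \o hol a = id
    by apply: funext => t; have /(congr1 (fun h => plfun h t)) := hol_inv a.
Qed.

End SquierRepresentation.

(** * The order on the diagram group *)

Local Open Scope group_scope.

Theorem theorem6p1 :
  forall (K : dcomplex2) (w : npath K),
  exists lt : rel (diagram_group w),
    [/\ irreflexive lt,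
        transitive lt,
        (forall a b : diagram_group w, a <> b -> lt a b \/ lt b a)
      & forall a b c : diagram_group w,
          lt a b -> lt (c * a) (c * b) /\ lt (a * c) (b * c)].
Proof.
move=> K w; have [clt tot] := exists_strict_total (dcell K).
pose X := squier K.
pose posg (x : diagram_group w) := positive_loop clt (loop_edges (repr (x : @pi1 X w))).
(* Positivity is tested on a chosen representative; homotopy invariance makes the choice
   immaterial. *)
have posE (a : @loop X w) : positive_loop clt a -> posg (\pi_(@pi1 X w) a)%qT.
  by apply: positive_loop_homotopic => //; apply/pi1P; rewrite reprK.
have pos1 : ~ posg 1.
  move=> /(positive_loop_homotopic tot (b := @loop_one X w)) h.
  apply: not_positive_one; apply: h; apply/pi1P; by rewrite reprK.
have posM x y : posg x -> posg y -> posg (x * y).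
  by move=> px py; apply: posE; apply: positive_loop_mul.
have posJ x y : posg x -> posg (y * x * y^-1).
  move=> px; have := positive_loop_conj tot (repr (y : @pi1 X w)) px.
  move=> /posE; rewrite -pi1_mulE -(pi1_mulE (repr _)) !reprK; exact.
have posV x : x <> 1 -> posg x \/ posg x^-1.
  move=> x1; have [|p|p] := @positive_loop_total K clt tot w (repr (x : @pi1 X w)).
  - by move=> /pi1P; rewrite reprK.
  - by left.
  - by right; apply: posE.
(* With this order, left invariance is immediate and right invariance is closure of the positive
   cone under conjugation. *)
exists (fun a b => `[< posg (a^-1 * b) >]); split.
- by move=> a; apply/asboolP; rewrite mulVg.
- move=> b a c /asboolP ab /asboolP bc; apply/asboolP.
  by have := posM _ _ ab bc; rewrite mulgA mulgK.
- move=> a b ab; have [|p|p] := posV (a^-1 * b).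
  + by move=> h; apply: ab; rewrite -[a]mulg1 -h mulVKg.
  + by left; apply/asboolP.
  + by right; apply/asboolP; rewrite invgM invgK in p.
- move=> a b c /asboolP ab; split; apply/asboolP.
    by rewrite invgM -mulgA mulKg.
  by have := posJ _ c^-1 ab; rewrite invgK invgM !mulgA.
Qed.
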